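(* Let $\mathcal{A}=\mathcal{A}(B_2)$ be the Coxeter arrangement of type $B_2$ with defining polynomial $Q(\mathcal{A})=xy(x-y)(x+y)$. For $k\in\mathbb{Z}_{\geq 0}$ define the Coxeter multiarrangement $(\mathcal{A},m_k)$ by $$Q(\mathcal{A},m_k)=x^2y^k(x-y)^1(x+y)^k .$$ If $k\geq 4$, then there does not exist a free extension of $(\mathcal{A},m_k)$.
   Context: Let $\mathbb{K}$ be a field. An arrangement in a finite-dimensional vector space $V$ over $\mathbb{K}$ is a finite set of hyperplanes; all arrangements here are central, i.e. every hyperplane is a linear subspace $H=\ker(\alpha_H)$ with $\alpha_H$ a nonzero linear form. An $\ell$-arrangement is one with $\dim V=\ell$. Let $S=S(V^* )\cong\mathbb{K}[x_1,\dots,x_\ell]$. A multiarrangement $(\mathcal{A},m)$ is an arrangement with a function $m:\mathcal{A}\to\mathbb{Z}_{\geq 0}$ (a multiplicity); its defining polynomial is $Q(\mathcal{A},m)=\prod_{H\in\mathcal{A}}\alpha_H^{m(H)}$. A simple arrangement is one with $m\equiv 1$. $D(\mathcal{A},m)=\{\theta\in\mathrm{Der}_{\mathbb{K}}(S)\mid \theta(\alpha_H)\in\alpha_H^{m(H)}S \text{ for all } H\in\mathcal{A}\}$, and $(\mathcal{A},m)$ is free if $D(\mathcal{A},m)$ is a free $S$-module (a simple arrangement is free if this holds for $m\equiv1$). Multiarrangements in a 2-dimensional space are always free. Ziegler restriction: for a simple arrangement $\mathcal{E}$ and $H\in\mathcal{E}$, $\mathcal{E}^H=\{H\cap H'\mid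 H'\in\mathcal{E}\setminus\{H\}\}$, an arrangement in $H$, with multiplicity $m^H(X)=|\mathcal{E}_X|-1$, where $\mathcal{E}_X=\{H'\in\mathcal{E}\mid X\subseteq H'\}$. A simple $(\ell+1)$-arrangement $\mathcal{E}$ is an extension of the free $\ell$-multiarrangement $(\mathcal{A},m)$ if there is $H\in\mathcal{E}$ with $(\mathcal{E}^H,m^H)=(\mathcal{A},m)$ (with $H$ identified linearly with the ambient space of $\mathcal{A}$). It is a free extension if $\mathcal{E}$ is moreover free.
   Formalization: The field K is assumed to have characteristic 0: in characteristic p ≥ 5 the multiarrangement (A, m_p) does have a free extension, and in characteristic 2 the polynomial xy(x-y)(x+y) does not define four distinct lines. *)

(* Defs.v *)
From HB Require Import structures.
From mathcomp Require Import all_boot all_order all_algebra.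
From mathcomp Require Import finmap.
From mathcomp Require Import mpoly.

Set Implicit Arguments.
Unset Strict Implicit.
Unset Printing Implicit Defensive.

Import GRing.Theory.
Local Open Scope fset_scope.
Local Open Scope ring_scope.

(* The ambient space is V = 'rV[K]_n, and S(V^* ) is {mpoly K[n]}.  A linear
   form on V is given by the column a of its coefficients: its value at v is
   v *m a, and the element of S that it defines is [formp a].               *)

Section Arrangements.
Variables (K : fieldType) (n : nat).
Local Notation S := {mpoly K[n]}.
Local Notation space := {vspace 'rV[K]_n}.
Implicit Types (a : 'cV[K]_n) (A : {fset space}) (m : space -> nat).

Definition formp a : S := \sum_(i < n) a i 0 *: 'X_i.

Definition kerform a : space := lker (linfun (mulmxr a : 'rV[K]_n -> 'M[K]_1)).

Definition hyperplane (H : space) : Prop :=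
  exists2 a : 'cV[K]_n, a != 0 & H = kerform a.

Definition arrangement A : Prop := forall H, H \in A -> hyperplane H.

Definition derivation (theta : {linear S -> S}) : Prop :=
  forall f g : S, theta (f * g) = theta f * g + f * theta g.

(* D(A, m).  The quantifier ranges over all the nonzero forms defining the
   hyperplanes of A; two such forms for the same H differ by a unit of K, so
   this amounts to fixing one alpha_H for each H.  Only the values of m on A
   matter.                                                                   *)
Definition logder A m (theta : {linear S -> S}) : Prop :=
  derivation theta /\
  forall a, a != 0 -> kerform a \in A ->
    exists g : S, theta (formp a) = g * formp a ^+ m (kerform a).

(* D(A, m) has a basis over S.  It is a submodule of the Noetherian module
   Der_K(S), so only finite bases need to be considered.                     *)
Definition free_multiarrangement A m : Prop :=
  exists (r : nat) (theta : 'I_r -> {linear S -> S}),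
    (forall i, logder A m (theta i)) /\
    (forall eta : {linear S -> S}, logder A m eta ->
       exists! c : {ffun 'I_r -> S},
         forall f : S, eta f = \sum_(i < r) c i * theta i f).

Definition free_arrangement A : Prop := free_multiarrangement A (fun=> 1%N).

(* The Ziegler restriction (E^H, m^H); the members of E^H are kept as
   subspaces of V contained in H.                                            *)
Definition restriction (E : {fset space}) (H : space) : {fset space} :=
  [fset (H :&: H')%VS | H' in E `\ H].

Definition ziegler_mult (E : {fset space}) (X : space) : nat :=
  (#|` [fset H' in E | (X <= H')%VS]| - 1)%N.

End Arrangements.

Section Extensions.
Variables (K : fieldType) (l : nat).
Variables (A : {fset {vspace 'rV[K]_l}}) (m : {vspace 'rV[K]_l} -> nat).

(* phi is the linear identification of the ambient space of A with H.  The
   freeness of (A, m) is not part of the definition.                         *)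
Definition extension (E : {fset {vspace 'rV[K]_l.+1}}) : Prop :=
  arrangement E /\
  exists2 H : {vspace 'rV[K]_l.+1}, H \in E &
    exists phi : 'Hom('rV[K]_l, 'rV[K]_l.+1),
      [/\ lker phi = 0%VS, limg phi = H,
          [fset (phi @: X)%VS | X in A] = restriction E H
        & forall X, X \in A -> m X = ziegler_mult E (phi @: X)%VS].

Definition free_extension (E : {fset {vspace 'rV[K]_l.+1}}) : Prop :=
  extension E /\ free_arrangement E.

End Extensions.

Section TypeB2.
Variable K : fieldType.

Definition form_x : 'cV[K]_2 := delta_mx 0 0.
Definition form_y : 'cV[K]_2 := delta_mx 1 0.

Definition B2 : {fset {vspace 'rV[K]_2}} :=
  [fset kerform form_x; kerform form_y;
        kerform (form_x - form_y); kerform (form_x + form_y)].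

(* Q(B2, m_k) = x^2 y^k (x - y)^1 (x + y)^k.  The four lines are distinct as
   soon as K does not have characteristic 2.  In odd characteristic p >= 5,
   (B2, m_p) has a free extension: add the plane at infinity to the lines y = b
   and x + y = d for all b, d in F_p, to two lines x = a with a in F_p, and to
   the line x = y.  So nonexistence for all k >= 4 needs characteristic 0.   *)
Definition B2_mult (k : nat) (H : {vspace 'rV[K]_2}) : nat :=
  if H == kerform form_x then 2%N
  else if H == kerform form_y then k
  else if H == kerform (form_x - form_y) then 1%N
  else if H == kerform (form_x + form_y) then k
  else 0%N.

End TypeB2.

(* Main.v *)
(* A free 3-arrangement of N planes has exponents (1, p, q) with p + q = N - 1,
   and counting the derivations of every large degree d computes 1 + p^2 + q^2
   from the intersection pattern of the planes.  Only an upper bound is needed: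
   building the arrangement one plane at a time, a new plane alpha imposes at
   least d + 1 - (#planes present - #lines they cut on alpha) conditions,
   because derivations of the form (product of all the other forms but one) *
   (constant field) already hit alpha's quotient in a large ideal.

   For an extension of (B2, m_k), seen in the affine chart given by the plane H
   at infinity, the planes are two lines x = a1, a2, k lines y = b, k lines
   x + y = d and one line x - y = c, and the bound forces the three sets
   D - a1, D - a2 and (D - c)/2 to lie in B up to at most two points in total,
   where B and D are the sets of the b and of the d.  Then B is nearly stable
   under an affine map of ratio 1/2, so it is a dyadic chain {u 2^i}, possibly
   with its centre; but a nonzero translation maps at most two points of such a
   chain to points of the chain, which is impossible for k >= 4. *)

Require Import Defs.
From HB Require Import structures.
From mathcomp Require Import all_boot all_order all_algebra.
From mathcomp Require Import finmap mpoly.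
From mathcomp Require Import ring zify.

Set Implicit Arguments.
Unset Strict Implicit.
Unset Printing Implicit Defensive.

Import GRing.Theory.
Local Open Scope ring_scope.

(** * Homogeneous polynomials and linear forms *)

Section Homogeneous.
Variables (K : fieldType) (n : nat).
Local Notation S := {mpoly K[n]}.
Implicit Types (p q : S) (a b : 'cV[K]_n) (w : 'rV[K]_n).

Lemma pihomogM d e p q :
  q \is e.-homog -> pihomog mdeg (d + e) (p * q) = pihomog mdeg d p * q.
Proof.
move=> hq; rewrite {1}(pihomog_partitionE (leq_addr d.+1 (msize p))).
rewrite mulr_suml raddf_sum /=.
have hd : (d < msize p + d.+1)%N by rewrite addnS ltnS leq_addl.
rewrite (bigD1 (Ordinal hd)) //= pihomog_dE; last exact/dhomogM/hq/pihomogP.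
rewrite big1 ?addr0 // => i neq_i.
rewrite (@pihomog_ne0 _ _ _ (i + e)%N) //; last exact/dhomogM/hq/pihomogP.
by rewrite eqn_add2r; apply: contraNneq neq_i => h; apply/eqP/val_inj.
Qed.

Lemma pihomogM_lt d e p q :
  q \is e.-homog -> (d < e)%N -> pihomog mdeg d (p * q) = 0.
Proof.
move=> hq lt_de; rewrite {1}(pihomog_partitionE (leqnn (msize p))).
rewrite mulr_suml raddf_sum /= big1 // => i _.
rewrite (@pihomog_ne0 _ _ _ (i + e)%N) //; last exact/dhomogM/hq/pihomogP.
by rewrite gtn_eqF // (leq_trans lt_de) ?leq_addl.
Qed.

Lemma dhomog0C p : p \is 0.-homog -> exists c, p = c%:MP.
Proof.
move=> /dhomogP hp; exists p@_0.
apply/mpolyP=> m; rewrite mcoeffC.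
have [->|nz_m] := eqVneq m 0%MM; first by rewrite mulr1.
rewrite mulr0; apply: memN_msupp_eq0; apply/negP => /hp /= /eqP.
by rewrite mdeg_eq0 (negPf nz_m).
Qed.

Lemma dhomogC (c : K) : (c%:MP : S) \is 0.-homog.
Proof. by rewrite -[c%:MP]mulr1 mul_mpolyC dhomogZ ?dhomog1. Qed.

Lemma dhomogXU i : ('X_i : S) \is 1.-homog.
Proof. by rewrite dhomogX; apply/eqP/mdeg1. Qed.

Lemma dhomogS_decomp d p : p \is d.+1.-homog ->
  exists2 h : 'I_n -> S, (forall i, h i \is d.-homog) & p = \sum_i 'X_i * h i.
Proof.
move=> hp; rewrite [p]mpolyE big_seq.
apply: (big_ind (fun p => exists2 h : 'I_n -> S, (forall i, h i \is d.-homog)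
  & p = \sum_i 'X_i * h i)).
- by exists (fun=> 0) => [i|]; rewrite ?dhomog0 // big1 // => i _; rewrite mulr0.
- move=> _ _ [h hh ->] [h' hh' ->]; exists (fun i => h i + h' i) => [i|].
    exact: dhomogD.
  by rewrite -big_split; apply: eq_bigr => i _; rewrite mulrDr.
move=> m /(dhomog_mf hp) /= deg_m.
have [i nz_mi] : exists i, m i != 0%N.
  apply/existsP; rewrite -negb_forall; apply/negP => /forallP m0.
  by move: deg_m; rewrite mdegE big1 // => i _; apply/eqP.
have le_m : (U_(i) <= m)%MM by rewrite lep1mP.
exists (fun j => if j == i then p@_m *: 'X_[m - U_(i)] else 0) => [j|].
  case: eqP => _; last exact: dhomog0.
  apply: dhomogZ; rewrite dhomogX; apply/eqP => /=.
  have := mdegD (m - U_(i))%MM U_(i); rewrite submK // mdeg1 addn1 deg_m.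
  by move=> [].
rewrite (bigD1 i) //= eqxx big1 => [|j /negPf->]; last by rewrite mulr0.
by rewrite addr0 -scalerAr -mpolyXD addmC submK.
Qed.

Lemma formp_homog a : formp a \is 1.-homog.
Proof. by apply: rpred_sum => i _; apply/dhomogZ/dhomogXU. Qed.

Lemma formp_is_linear : linear (@formp K n).
Proof.
move=> c a b; rewrite /formp scaler_sumr -big_split; apply: eq_bigr => i _ /=.
by rewrite !mxE scalerDl scalerA.
Qed.
HB.instance Definition _ :=
  GRing.isLinear.Build K 'cV[K]_n S _ (@formp K n) formp_is_linear.

Lemma formp_coeff a i : (formp a)@_U_(i) = a i 0.
Proof.
rewrite raddf_sum (bigD1 i) //= mcoeffZ mcoeffXU eqxx mulr1 big1 ?addr0 // => j.
by move=> neq_ji; rewrite mcoeffZ mcoeffXU (negPf neq_ji) mulr0.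
Qed.

Lemma formp_inj : injective (@formp K n).
Proof.
move=> a b eq_ab; apply/colP => i; by rewrite -!formp_coeff eq_ab.
Qed.

Lemma formp_eq0 a : (formp a == 0) = (a == 0).
Proof. by rewrite -(raddf0 (@formp K n)) (inj_eq formp_inj). Qed.

Lemma meval_formp a w : (formp a).@[w 0] = (w *m a) 0 0.
Proof.
rewrite raddf_sum mxE; apply: eq_bigr => i _ /=.
by rewrite mevalZ mevalXU mulrC.
Qed.

End Homogeneous.

(** * Restriction of polynomials to a hyperplane *)

Section RestrictionToHyperplane.
Variables (K : fieldType) (n : nat).
Local Notation S := {mpoly K[n]}.
Implicit Types (p q : S) (a b : 'cV[K]_n).

(* Eliminates one variable by means of the equation [formp a = 0]. *)
Definition elim_tuple a : n.-tuple S :=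
  [tuple 'X_i - (if [pick j | a j 0 != 0] is Some j
                 then ((i == j)%:R / a j 0) *: formp a else 0) | i < n].

(** A model of the quotient map from S to S modulo [formp a], with values in S itself: a graded ring
    morphism whose kernel is the ideal of [formp a]. Values lie in a domain, so nonzero restrictions
    have nonzero products. *)
Definition restr a : S -> S := comp_mpoly (elim_tuple a).
HB.instance Definition _ a := GRing.LRMorphism.on (restr a).

Lemma restrXU a i : restr a 'X_i =
  'X_i - (if [pick j | a j 0 != 0] is Some j
          then ((i == j)%:R / a j 0) *: formp a else 0).
Proof. by rewrite /restr comp_mpolyXU -tnth_nth tnth_mktuple. Qed.

Lemma restr_homog a d p : p \is d.-homog -> restr a p \is d.-homog.
Proof.
elim: d p => [|d IHd] p hp.
  by have [c ->] := dhomog0C hp; rewrite /restr comp_mpolyC dhomogC.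
have [h hh ->] := dhomogS_decomp hp; rewrite rmorph_sum.
apply: rpred_sum => i _; rewrite rmorphM /= -add1n.
apply: dhomogM; last exact: IHd.
rewrite restrXU; apply: rpredB; first exact: dhomogXU.
by case: pickP => [j _|_]; rewrite ?dhomog0 // dhomogZ // formp_homog.
Qed.

Lemma restr_mod a p : exists g, p - restr a p = g * formp a.
Proof.
elim/mpolyind: p => [|c m p _ _ [g Hg]].
  by exists 0; rewrite rmorph0 subrr mul0r.
suff [g' Hg'] : exists g, 'X_[m] - restr a 'X_[m] = g * formp a.
  exists (c *: g' + g); rewrite linearP /= mulrDl -scalerAl -Hg' -Hg.
  by rewrite scalerBr opprD addrACA.
rewrite mpolyXE_id; elim/big_ind: _ => [|p1 p2 [g1 H1] [g2 H2]|i _].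
- by exists 0; rewrite rmorph1 subrr mul0r.
(* With r the restriction, pq - r(p) r(q) = (p - r(p)) q + r(p) (q - r(q)). *)
- exists (g1 * p2 + restr a p1 * g2); rewrite rmorphM.
  by rewrite mulrDl mulrAC -H1 -mulrA -H2 mulrBl mulrBr addrA subrK.
elim: (m i) => [|k [gk Hk]]; first by exists 0; rewrite rmorph1 subrr mul0r.
have [gi Hi] : exists g, 'X_i - restr a 'X_i = g * formp a.
  rewrite restrXU opprB addrC subrK.
  case: pickP => [j _|_]; last by exists 0; rewrite mul0r.
  by exists ((i == j)%:R / a j 0)%:MP; rewrite mul_mpolyC.
exists (gi * 'X_i ^+ k + restr a 'X_i * gk); rewrite exprS rmorphM.
by rewrite mulrDl mulrAC -Hi -mulrA -Hk mulrBl mulrBr addrA subrK.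
Qed.

Lemma restr_formp a : restr a (formp a) = 0.
Proof.
rewrite raddf_sum /=; under eq_bigr => i _ do rewrite linearZ /= restrXU.
case: pickP => [j nz_aj|a0]; last first.
  by apply: big1 => i _; rewrite (eqP (negbFE (a0 i))) scale0r.
under eq_bigr => i _ do rewrite scalerBr scalerA.
rewrite sumrB [X in _ - X](_ : _ = formp a) ?subrr //.
rewrite (bigD1 j) //= eqxx mulrA mulr1 divff // scale1r.
rewrite big1 ?addr0 // => i /negPf->.
by rewrite mul0r mulr0 scale0r.
Qed.

Lemma restr_eq0P a p : restr a p = 0 <-> exists g, p = g * formp a.
Proof.
split=> [p0|[g ->]]; last by rewrite rmorphM /= restr_formp mulr0.
by have [g] := restr_mod a p; rewrite p0 subr0; exists g.
Qed.

Lemma restr_eq0_homog a d p : p \is d.+1.-homog -> restr a p = 0 ->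
  exists2 g, g \is d.-homog & p = g * formp a.
Proof.
move=> hp /restr_eq0P[g def_p]; exists (pihomog mdeg d g); first exact: pihomogP.
by rewrite -(pihomogM _ _ (formp_homog a)) addn1 -def_p pihomog_dE.
Qed.

Lemma restr_eq0_homog0 a p : p \is 0.-homog -> restr a p = 0 -> p = 0.
Proof.
move=> hp /restr_eq0P[g def_p]; rewrite -(pihomog_dE hp) def_p.
exact: (pihomogM_lt _ (formp_homog a)).
Qed.

Lemma restr_formp_eq0 a b : restr a (formp b) = 0 -> exists c, b = c *: a.
Proof.
move=> /(restr_eq0_homog (formp_homog b))[g /dhomog0C[c ->] def_b].
by exists c; apply: formp_inj; rewrite def_b linearZ /= mul_mpolyC.
Qed.

End RestrictionToHyperplane.

(** * Independent triples of forms in three variables *)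

Section Frames.
Variable K : fieldType.
Local Notation S := {mpoly K[3]}.
Implicit Types (p q h : S) (a b c : 'cV[K]_3) (w : 'rV[K]_3).

(** Linear independence of the three forms: their planes meet only in the origin. In the projective
    plane, the three lines have no common point. *)
Definition frame a b c : Prop :=
  forall w, w *m a = 0 -> w *m b = 0 -> w *m c = 0 -> w = 0.

Lemma frame_span a b c : frame a b c ->
  forall u : 'cV[K]_3, exists x y z, u = x *: a + y *: b + z *: c.
Proof.
move=> fr u; pose M : 'M[K]_(3, 1 + 1 + 1) := row_mx (row_mx a b) c.
have Mfree : row_free M.
  rewrite -kermx_eq0; apply/rowV0P => w /sub_kermxP.
  rewrite /M !mul_mx_row => /eqP; rewrite row_mx_eq0 => /andP[].
  by rewrite row_mx_eq0 => /andP[/eqP wa /eqP wb] /eqP wc; apply: fr.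
have M_unit : (M : 'M[K]_3) \in unitmx by rewrite -row_free_unit.
pose v : 'cV[K]_(1 + 1 + 1) := invmx (M : 'M[K]_3) *m u.
exists (usubmx (usubmx v) 0 0), (dsubmx (usubmx v) 0 0), (dsubmx v 0 0).
have -> : u = row_mx (row_mx a b) c *m v by rewrite /v -/M (mulKVmx M_unit).
have col1 (d : 'cV[K]_3) (x : 'M[K]_1) : d *m x = x 0 0 *: d.
  by rewrite {1}[x]mx11_scalar mul_mx_scalar.
by rewrite -{1}[v]vsubmxK -{1}[usubmx v]vsubmxK !mul_row_col !col1.
Qed.

Lemma common_point a b : exists2 w : 'rV[K]_3, w != 0 & w *m a = 0 /\ w *m b = 0.
Proof.
have : kermx (row_mx a b) != 0.
  by rewrite -mxrank_eq0 mxrank_ker subn_eq0 -ltnNge ltnS rank_leq_col.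
case/rowV0Pn => w /sub_kermxP; rewrite mul_mx_row => /eqP.
by rewrite row_mx_eq0 => /andP[/eqP wa /eqP wb] nz_w; exists w.
Qed.

(** Modulo [formp a] and [formp b], the ring S becomes a polynomial ring in the single variable
    [formp c], so one power survives in each degree. The cofactors are not claimed to be
    homogeneous. *)
Lemma homog_frame_expansion a b c : frame a b c -> forall e h, h \is e.-homog ->
  exists x h1 h2, h = x *: formp c ^+ e + h1 * formp a + h2 * formp b.
Proof.
move=> fr; elim=> [|e IHe] h hh.
  have [x ->] := dhomog0C hh; exists x, 0, 0.
  by rewrite !mul0r !addr0 expr0 -mul_mpolyC mulr1.
have [g hg ->] := dhomogS_decomp hh.
apply: (big_ind (fun h => exists x h1 h2,
  h = x *: formp c ^+ e.+1 + h1 * formp a + h2 * formp b)).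
- by exists 0, 0, 0; rewrite scale0r !mul0r !addr0.
- move=> _ _ [x [h1 [h2 ->]]] [x' [h1' [h2' ->]]].
  exists (x + x'), (h1 + h1'), (h2 + h2'); rewrite -!mul_mpolyC rmorphD /=.
  by set E := _ ^+ _; ring.
move=> i _; have [x [h1 [h2 ->]]] := IHe _ (hg i).
have -> : 'X_i = formp (delta_mx i 0 : 'cV[K]_3).
  rewrite /formp (bigD1 i) //= mxE !eqxx scale1r big1 ?addr0 // => j /negPf ne.
  by rewrite mxE ne scale0r.
have [y1 [y2 [z ->]]] := frame_span fr (delta_mx i 0).
rewrite !linearD !linearZ /= -!mul_mpolyC.
set l := _ + _ + _.
exists (z * x), (l * h1 + x%:MP * y1%:MP * formp c ^+ e),
  (l * h2 + x%:MP * y2%:MP * formp c ^+ e).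
rewrite -!mul_mpolyC rmorphM exprS /= /l; set E := _ ^+ _.
ring.
Qed.

(* On the plane [formp a = 0], the products of all but one of r pairwise
   independent forms span the forms of degree r - 1, and hence of every larger
   degree. *)
Lemma products_span a (P : seq 'cV[K]_3) (Phi : S -> Prop) :
    uniq P -> {in P &, forall b c, b != c -> frame a b c} -> P != [::] ->
    (forall p q, Phi p -> Phi q -> Phi (p + q)) ->
  forall e f, (size P <= e.+1)%N ->
    {in P, forall b g, g \is (e - (size P).-1).-homog ->
       Phi (f * \prod_(c <- rem b P) formp c * g)} ->
    (forall e' g, e'.+1 = e -> g \is e'.-homog -> Phi (f * g * formp a)) ->
  forall h, h \is e.-homog -> Phi (f * h).
Proof.
move=> uP frP nzP PhiD.
elim: P uP frP nzP => // b [|c P] IHP uP frP _ e f le_e PhiP Phia h hh.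
  by have := PhiP b (mem_head _ _) h; rewrite /= eqxx subn0 big_nil mulr1; apply.
case: e => [|e] // in le_e PhiP Phia hh *.
(* Multiples of [formp b] are reached by induction on the list: [formp b] moves into the factor [f]
   and the degree drops by one. *)
have Phib g : g \is e.-homog -> Phi (f * formp b * g).
  move/andP: uP => [nPb uP].
  apply: (IHP uP) => //; first by move=> p q hp hq; apply: frP; rewrite inE ?hp ?hq orbT.
    move=> d Pd g' hg'; have := PhiP d _ g'; rewrite inE Pd orbT => /(_ isT).
    have -> : rem d [:: b, c & P] = b :: rem d (c :: P).
      by rewrite /=; case: eqP => // eq_bd; rewrite eq_bd Pd in nPb.
    by rewrite big_cons !mulrA /= subSS; apply.
  move=> e' g' def_e hg'.
  have := Phia e (formp b * g') erefl; rewrite !mulrA; apply.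
  by rewrite -def_e -(add1n e') dhomogM // formp_homog.
have neq_bc : b != c by move: uP; rewrite /= inE negb_or -andbA => /andP[].
have fr : frame a b c by apply: frP; rewrite ?inE ?eqxx ?orbT.
(* [w] spans the intersection of the planes of [a] and [b]; by independence no other form of the
   list vanishes there. *)
have [w nz_w [wa wb]] := common_point a b.
have nzw d : d \in c :: P -> (formp d).@[w 0] != 0.
  move=> Pd; apply: contra_neq nz_w; rewrite meval_formp => wd0.
  apply: (frP b d); rewrite ?inE ?eqxx // ?orbT //.
  - by rewrite -in_cons Pd orbT.
  - by move: uP => /andP[nPb _]; apply: contraNneq nPb => ->.
  by rewrite [LHS]mx11_scalar wd0 raddf0.
(* [t] has the degree of [h], is divisible by every form of the list but [b], and does not vanish at
   [w]. Hence it spans this degree modulo [formp a] and [formp b]. *)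
pose t := \prod_(d <- c :: P) formp d * formp c ^+ (e.+1 - size (c :: P)).
have ht : t \is e.+1.-homog.
  rewrite -[X in X.-homog](subnKC (m := size (c :: P)) (n := e.+1)) //.
  apply: dhomogM; last by rewrite -[X in X.-homog]mul1n dhomogMn ?formp_homog.
  elim: (c :: P) => [|d Q IHQ]; first by rewrite big_nil dhomog1.
  by rewrite big_cons /= -(add1n (size Q)) dhomogM ?formp_homog.
have [x [t1 [t2 def_t]]] := homog_frame_expansion fr ht.
have [y [h1 [h2 def_h]]] := homog_frame_expansion fr hh.
have nz_x : x != 0.
  have : t.@[w 0] != 0.
    rewrite mevalM rmorphXn /= mulf_neq0 ?expf_neq0 ?nzw ?mem_head //.
    rewrite rmorph_prod prodf_seq_neq0; apply/allP => d Pd /=.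
    exact: nzw.
  apply: contraNneq => x0; rewrite def_t x0 scale0r add0r mevalD !mevalM.
  by rewrite !meval_formp wa wb mxE !mulr0 addr0.
have {def_h} : h = (y / x) *: t + (h1 - (y / x) *: t1) * formp a
                     + (h2 - (y / x) *: t2) * formp b.
  rewrite {1}def_t {1}def_h !scalerDr scalerA divfK // !mulrBl -!scalerAl.
  set A := y *: _; set B := h1 * _; set C := h2 * _; set D := _ *: _; set E := _ *: _.
  ring.
(* Passing to the component of this degree makes both cofactors homogeneous. *)
move/(congr1 (pihomog mdeg e.+1)); rewrite (pihomog_dE hh) !raddfD /=.
rewrite -[e.+1]addn1 !(pihomogM _ _ (formp_homog _)) addn1.
rewrite pihomog_dE ?dhomogZ // => ->; rewrite !mulrDr.
apply: (PhiD _ _ _); first apply: (PhiD _ _ _).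
- have := PhiP b (mem_head _ _) ((y / x) *: formp c ^+ (e.+1 - size (c :: P))).
  rewrite /= eqxx -scalerAr => Phib'; rewrite -scalerAr /t mulrA.
  apply: Phib'; apply: dhomogZ.
  by rewrite -[X in X.-homog]mul1n dhomogMn ?formp_homog.
- by rewrite mulrA; apply: (Phia e) => //; apply: pihomogP.
- by rewrite mulrA mulrAC; apply: Phib; apply: pihomogP.
Qed.

End Frames.

(** * Logarithmic vector fields of a given degree *)

Section HomogeneousParts.
Variables (K : fieldType) (n : nat).
Local Notation S := {mpoly K[n]}.

Definition homog_part d (p : S) : dhomog n K d := DHomog (pihomogP mdeg d p).

Lemma homog_part_is_linear d : linear (homog_part d).
Proof. by move=> c p q; apply: val_inj; rewrite /= linearP. Qed.
HB.instance Definition _ d :=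
  GRing.isLinear.Build K S (dhomog n K d) _ (homog_part d)
    (homog_part_is_linear d).

End HomogeneousParts.

Section LogarithmicVectors.
Variable K : fieldType.
Local Notation S := {mpoly K[3]}.
Local Notation T := (dhomog 3 K).
Local Notation V d := {ffun 'I_3 -> T d}.
Implicit Types (p q f g h : S) (a b c : 'cV[K]_3) (L P : seq 'cV[K]_3).

Definition pairing a (v : 'I_3 -> S) : S := \sum_i a i 0 *: v i.

(** If [v] gives the coefficients of a derivation, [pairing a v] is its value at [formp a]; so this
    is membership in the logarithmic module of the planes listed by [L]. *)
Definition logvec L (v : 'I_3 -> S) : Prop :=
  {in L, forall a, exists g, pairing a v = g * formp a}.

Lemma pairing_homog a d (v : 'I_3 -> S) :
  (forall i, v i \is d.-homog) -> pairing a v \is d.-homog.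
Proof. by move=> hv; apply: rpred_sum => i _; apply: dhomogZ. Qed.

Lemma dim_dhomog d : \dim {: T d} = 'C(d + 2, d).
Proof. by rewrite dimvf. Qed.

Definition restr_hom a d : 'Hom(T d, T d) :=
  linfun (homog_part d \o restr a \o @mpoly_of_dhomog 3 K _).

Lemma restr_homE a d (h : T d) : restr_hom a d h = restr a h :> S.
Proof. by rewrite lfunE /= pihomog_dE // restr_homog // dhomog_is_dhomog. Qed.

(** Multiplication by [f] between graded pieces. [homog_part] forces the target degree and is
    harmless when [f] has degree [d - e] and [e <= d]. *)
Definition mul_hom f e d : 'Hom(T e, T d) :=
  linfun (homog_part d \o (f \o* @mpoly_of_dhomog 3 K e)).

Lemma mul_homE f e d (h : T e) : f \is (d - e).-homog -> (e <= d)%N ->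
  mul_hom f e d h = (h : S) * f :> S.
Proof.
move=> hf le_ed; rewrite lfunE /= pihomog_dE // -(subnKC le_ed).
by rewrite dhomogM // dhomog_is_dhomog.
Qed.

(** In degree d+1 the kernel is [formp a] times the forms of degree d, and Pascal's rule gives the
    difference of dimensions; in degree 0 it is zero. *)
Lemma dim_restr_ker a d : a != 0 ->
  (\dim (lker (restr_hom a d)) + d.+1 = 'C(d + 2, d))%N.
Proof.
move=> nz_a; case: d => [|d].
  rewrite add0n bin0; apply/eqP; rewrite -[X in _ == X]add0n eqn_add2r dimv_eq0 -subv0.
  apply/subvP => h; rewrite memv_ker memv0 => /eqP h0; apply/eqP/val_inj.
  apply: (restr_eq0_homog0 (a := a)); first exact: dhomog_is_dhomog.
  by rewrite -restr_homE h0.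
have homogE (g : T d) : mul_hom (formp a) d d.+1 g = (g : S) * formp a :> S.
  by rewrite mul_homE // subSnn formp_homog.
have -> : lker (restr_hom a d.+1) = limg (mul_hom (formp a) d d.+1).
  apply/vspaceP => h; rewrite memv_ker; apply/eqP/memv_imgP.
    move=> h0; have [] := @restr_eq0_homog _ _ a d h.
    - exact: dhomog_is_dhomog.
    - by rewrite -restr_homE h0.
    move=> g hg def_h; exists (DHomog hg); first exact: memvf.
    by apply: val_inj; rewrite /= homogE def_h.
  case=> g _ ->; apply: val_inj; rewrite /= restr_homE homogE rmorphM /=.
  by rewrite restr_formp mulr0.
rewrite limg_dim_eq ?dim_dhomog; last first.
  apply/eqP; rewrite -subv0 capfv; apply/subvP => g.
  rewrite memv_ker memv0 => /eqP g0; apply/eqP/val_inj/eqP => /=.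
  have /eqP := homogE g; rewrite g0 eq_sym mulf_eq0 formp_eq0 (negPf nz_a) orbF.
  by [].
have sym m : 'C(m + 2, m) = 'C(m + 2, 2) by rewrite -[RHS]bin_sub ?leq_addl ?addnK.
by rewrite !sym !addn2 [RHS]binS bin1.
Qed.

Lemma dim_restr_img a d : a != 0 -> \dim (limg (restr_hom a d)) = d.+1.
Proof.
move=> nz_a; apply/eqP; rewrite -(eqn_add2l (\dim (lker (restr_hom a d)))).
rewrite dim_restr_ker // -dim_dhomog -(limg_ker_dim (restr_hom a d) fullv).
by rewrite capfv.
Qed.

Definition homog_pairing a d (v : V d) : T d := \sum_i a i 0 *: v i.

Lemma homog_pairing_is_linear a d : linear (@homog_pairing a d).
Proof.
move=> x u w; rewrite scaler_sumr -big_split; apply: eq_bigr => i _ /=.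
by rewrite !ffunE scalerDr !scalerA mulrC.
Qed.
HB.instance Definition _ a d :=
  GRing.isLinear.Build K (V d) (T d) _ (@homog_pairing a d)
    (@homog_pairing_is_linear a d).

Definition pairing_hom a d : 'Hom(V d, T d) := linfun (@homog_pairing a d).

Lemma pairing_homE a d (v : V d) : pairing_hom a d v = pairing a (fun i => v i) :> S.
Proof.
by rewrite lfunE /= raddf_sum.
Qed.

(** The degree [d] part of the logarithmic module, as a vector space cut out by one linear condition
    per plane: the restricted pairing vanishes. *)
Fixpoint logspace L d : {vspace V d} :=
  if L is a :: L' then
    (logspace L' d :&: lker (restr_hom a d \o pairing_hom a d))%VS
  else fullv.

Lemma logspaceP L d (v : V d) :
  v \in logspace L d <-> logvec L (fun i => v i).
Proof.
elim: L => [|a L IHL] /=; first by rewrite memvf; split.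
rewrite memv_cap memv_ker comp_lfunE.
have eq0 : (restr_hom a d (pairing_hom a d v) == 0) =
           (restr a (pairing a (fun i => v i)) == 0).
  by rewrite -pairing_homE -restr_homE.
split=> [/andP[/IHL Lv]|Lv].
  rewrite eq0 => /eqP/restr_eq0P av b; rewrite inE => /predU1P[-> //|].
  exact: Lv.
apply/andP; split; first by apply/IHL => b Lb; apply: Lv; rewrite inE Lb orbT.
by rewrite eq0; apply/eqP/restr_eq0P/Lv/mem_head.
Qed.

Lemma dim_logspace0 d : \dim (logspace [::] d) = (3 * 'C(d + 2, d))%N.
Proof. by rewrite dimvf /dim /= card_ord. Qed.

(** The condition of a new plane takes values in degree [d] of S modulo [formp a], a space of
    dimension d+1. *)
Lemma dim_logspace_cons_ge a L d : a != 0 ->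
  (\dim (logspace L d) <= \dim (logspace (a :: L) d) + d.+1)%N.
Proof.
move=> nz_a; rewrite -(limg_ker_dim (restr_hom a d \o pairing_hom a d) (logspace L d)).
rewrite leq_add2l limg_comp -(dim_restr_img d nz_a).
by apply/dimvS/limgS/subvf.
Qed.

End LogarithmicVectors.

(** * The number of conditions imposed by a new plane *)

Section Addition.
Variable K : fieldType.
Local Notation S := {mpoly K[3]}.
Local Notation T := (dhomog 3 K).
Local Notation V d := {ffun 'I_3 -> T d}.
Implicit Types (p q f g h : S) (a b c : 'cV[K]_3) (L P R : seq 'cV[K]_3).

Lemma dhomog_eq0 d (h : T d) : (h == 0) = ((h : S) == 0).
Proof. by rewrite -(inj_eq val_inj). Qed.

(** The values of the existing fields on the new plane contain all restrictions of multiples of [f].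
    Multiplication by the restriction of [f] is injective modulo [formp a], so these fill a space of
    dimension d - m + 1. *)
Lemma dim_logspace_cons_le_img a L d m f :
    a != 0 -> f \is m.-homog -> restr a f != 0 -> (m <= d)%N ->
    (forall h, h \is (d - m).-homog -> exists2 v : V d, v \in logspace L d &
       restr a (pairing a (fun i => v i)) = restr a (f * h)) ->
  (\dim (logspace (a :: L) d) + (d - m).+1 <= \dim (logspace L d))%N.
Proof.
move=> nz_a hf nz_f le_md surj.
rewrite -(limg_ker_dim (restr_hom a d \o pairing_hom a d) (logspace L d)) leq_add2l.
pose F := (restr_hom a d \o mul_hom f (d - m) d)%VF.
have FE (h : T (d - m)) : F h = restr a h * restr a f :> S.
  by rewrite /F comp_lfunE restr_homE mul_homE ?subKn ?leq_subr // rmorphM.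
have <- : \dim (limg F) = (d - m).+1.
  apply/eqP; rewrite -(eqn_add2l (\dim (lker F))).
  have kerF : lker F = lker (restr_hom a (d - m)).
    apply/vspaceP => h; rewrite !memv_ker !dhomog_eq0.
    by rewrite restr_homE FE mulf_eq0 (negPf nz_f) orbF.
  rewrite [X in _ == (\dim X + _)%N]kerF dim_restr_ker // -(dim_dhomog K).
  by rewrite -[X in (\dim X + _)%N]capfv limg_ker_dim.
apply/dimvS/subvP => _ /memv_imgP[h _ ->].
have [v Lv def_v] := surj h (dhomog_is_dhomog h).
apply/memv_imgP; exists v => //; apply: val_inj => /=.
by rewrite FE comp_lfunE restr_homE pairing_homE def_v rmorphM mulrC.
Qed.

Lemma prod_formp_homog L : \prod_(b <- L) formp b \is (size L).-homog.
Proof.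
elim: L => [|b L IHL]; first by rewrite big_nil dhomog1.
by rewrite big_cons /= -(add1n (size L)) dhomogM ?formp_homog.
Qed.

Lemma formp_dvd_prod b L : b \in L ->
  exists g, \prod_(c <- L) formp c = g * formp b.
Proof.
by move=> Lb; exists (\prod_(c <- rem b L) formp c); rewrite (big_rem b) //= mulrC.
Qed.

Lemma frame_dual a b c : frame a b c ->
  exists2 w : 'rV[K]_3, w *m b = 0 & (w *m a) 0 0 = 1.
Proof.
move=> fr; have [w nz_w [wb wc]] := common_point b c.
have nz_wa : (w *m a) 0 0 != 0.
  by apply: contra_neq nz_w => wa; apply: fr => //; rewrite [LHS]mx11_scalar wa raddf0.
exists (((w *m a) 0 0)^-1 *: w); first by rewrite -scalemxAl wb scaler0.
by rewrite -scalemxAl mxE mulVf.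
Qed.

Lemma frame_neq0 a b c : frame a b c -> a != 0.
Proof.
move=> /frame_dual[w _ wa]; apply: contra_eq_neq wa => ->.
by rewrite mulmx0 mxE eq_sym oner_eq0.
Qed.

Lemma frame_restr_neq0 a b c : frame a b c -> restr a (formp b) != 0.
Proof.
move=> fr; apply/eqP => /restr_formp_eq0[x def_b].
have [w /eqP + [wa wc]] := common_point a c; apply.
by apply: fr => //; rewrite def_b -scalemxAr wa scaler0.
Qed.

Lemma pairing_scale a (w : 'rV[K]_3) p :
  pairing a (fun i => w 0 i *: p) = (w *m a) 0 0 *: p.
Proof.
rewrite mxE scaler_suml; apply: eq_bigr => i _.
by rewrite scalerA mulrC.
Qed.

(** The field is the constant direction [w] times [p]: for each form, either [w] lies in its plane
    or the form divides [p]. *)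
Lemma const_logvec L d (w : 'rV[K]_3) p : p \is d.-homog ->
    {in L, forall b, w *m b = 0 \/ exists g, p = g * formp b} ->
  exists2 v : V d, v \in logspace L d &
    forall a, pairing a (fun i => v i) = (w *m a) 0 0 *: p.
Proof.
move=> hp Lp; exists [ffun i => w 0 i *: homog_part d p].
  apply/logspaceP => b Lb.
  rewrite [pairing _ _](_ : _ = (w *m b) 0 0 *: p); last first.
    rewrite -pairing_scale; apply: eq_bigr => i _.
    by rewrite ffunE /= pihomog_dE.
  have [->|[g ->]] := Lp b Lb; first by exists 0; rewrite mxE scale0r mul0r.
  by exists ((w *m b) 0 0 *: g); rewrite scalerAl.
move=> a; rewrite -pairing_scale; apply: eq_bigr => i _.
by rewrite ffunE /= pihomog_dE.
Qed.

Lemma dim_logspace1_le a d : a != 0 ->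
  (\dim (logspace [:: a] d) + d.+1 <= \dim (logspace [::] d : {vspace V d}))%N.
Proof.
move=> nz_a; have [w wa] : exists w : 'rV[K]_3, (w *m a) 0 0 = 1.
  have /cV0Pn[i nz_ai] := nz_a.
  exists ((a i 0)^-1 *: delta_mx 0 i); rewrite -scalemxAl -rowE !mxE mulVf //.
have := @dim_logspace_cons_le_img a [::] d 0 1 nz_a (dhomog1 _ _).
rewrite rmorph1 oner_eq0 subn0; apply=> // h hh; have [] := @const_logvec [::] d w h hh.
  by [].
by move=> v Lv Ev; exists v => //; rewrite Ev wa scale1r mul1r.
Qed.

(* The deletion-restriction inequality: [P] picks one member of [L] through
   each point of the line [ker a], so that adding the line [ker a] imposes at
   least [d + 1 - size R] conditions in degree [d]. *)
Lemma dim_logspace_cons_le a L P R d :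
    perm_eq L (P ++ R) -> P != [::] -> uniq P -> (size L <= d.+1)%N ->
    {in P &, forall b c, b != c -> frame a b c} ->
    {in L, forall b, exists c, frame a b c} ->
  (\dim (logspace (a :: L) d) + d.+1 <= \dim (logspace L d) + size R)%N.
Proof.
move=> eqL nzP uP le_d frP frL.
have nz_a : a != 0.
  case: P nzP {uP frP} eqL => // b P _ /perm_mem eqL.
  by have [c /frame_neq0] : exists c, frame a b c by apply: frL; rewrite eqL mem_head.
have sizeL : size L = (size P + size R)%N by rewrite (perm_size eqL) size_cat.
have P_gt0 : (0 < size P)%N by rewrite lt0n size_eq0.
have le_R : (size R <= d)%N by move: le_d; rewrite sizeL; lia.
suff: (\dim (logspace (a :: L) d) + (d - size R).+1 <= \dim (logspace L d))%N.
  rewrite -(leq_add2r (size R)) -addnA addSn subnK //.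
apply: (dim_logspace_cons_le_img nz_a (prod_formp_homog R)) => //.
  rewrite rmorph_prod prodf_seq_neq0; apply/allP => b Rb /=.
  have [c] : exists c, frame a b c by apply: frL; rewrite (perm_mem eqL) mem_cat Rb orbT.
  exact: frame_restr_neq0.
(* [Phi p] says that the class of [p] modulo [formp a] is the value of some logarithmic field. The
   aim is to reach every multiple of the product over [R]. *)
pose Phi p := exists2 v : V d, v \in logspace L d &
  restr a (pairing a (fun i => v i)) = restr a p.
apply: (products_span (a := a) (P := P) (Phi := Phi)) => //.
- move=> p q [v Lv Ev] [u Lu Eu]; exists (v + u); first exact: memvD.
  rewrite rmorphD /= -Ev -Eu -rmorphD /= -big_split /=.
  by congr restr; apply: eq_bigr => i _; rewrite ffunE -scalerDr.
- lia.
- move=> b Pb g hg.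
  (* The direction [w] lies in the plane of [b] and is transverse to that of [a]; it is multiplied
     by the forms of [R] and those of [P] other than [b]. *)
  have [c /frame_dual[w wb wa]] : exists c, frame a b c.
    by apply: frL; rewrite (perm_mem eqL) mem_cat Pb.
  set p := _ * g; have hp : p \is d.-homog.
    have -> : d = (size R + (size P).-1 + (d - size R - (size P).-1))%N by lia.
    by rewrite !dhomogM // ?prod_formp_homog // -(size_rem Pb) prod_formp_homog.
  have [|v Lv Ev] := @const_logvec L d w p hp.
    move=> l; rewrite (perm_mem eqL) mem_cat => PRl.
    have [->|neq_lb] := eqVneq l b; first by left.
    right; case/orP: PRl => [Pl|Rl].
      have [|q Eq] := @formp_dvd_prod l (rem b P).
        by rewrite (rem_filter _ uP) mem_filter /= neq_lb.
      by exists (\prod_(l <- R) formp l * q * g); rewrite /p Eq; ring.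
    have [q Eq] := formp_dvd_prod Rl.
    by exists (q * \prod_(l <- rem b P) formp l * g); rewrite /p Eq; ring.
  by exists v => //; rewrite Ev wa scale1r.
(* Multiples of [formp a] restrict to zero, the value of the zero field. *)
move=> e' g _ _; exists 0; first exact: mem0v.
rewrite [RHS]rmorphM /= restr_formp mulr0 [pairing _ _]big1 ?rmorph0 // => i _.
by rewrite ffunE; apply: scaler0.
Qed.

End Addition.

(** * Homogeneous bases *)

Section GradedNakayama.
Variables (K : fieldType) (n m : nat).
Local Notation S := {mpoly K[n]}.
Implicit Types (p q f : S) (v : 'rV[S]_m).

Lemma pihomog_mul d p q :
  pihomog mdeg d (p * q) = \sum_(j < d.+1) pihomog mdeg j p * pihomog mdeg (d - j) q.
Proof.
rewrite {1}(pihomog_partitionE (leq_addr d.+1 (msize p))) mulr_suml raddf_sum /=.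
have pi_mul j : pihomog mdeg d (pihomog mdeg j p * q) =
    if (j <= d)%N then pihomog mdeg j p * pihomog mdeg (d - j) q else 0.
  rewrite [_ * q]mulrC; case: leqP => [le_jd|lt_dj].
    by rewrite -{1}(subnK le_jd) pihomogM ?pihomogP // mulrC.
  by rewrite (@pihomogM_lt _ _ _ j) ?pihomogP.
under eq_bigr => j _ do rewrite pi_mul.
rewrite -(big_mkord xpredT (fun j => if (j <= d)%N then
  pihomog mdeg j p * pihomog mdeg (d - j) q else 0)).
rewrite (big_cat_nat (n := d.+1)) //=; last by rewrite leq_addl.
rewrite [X in _ + X]big1_seq ?addr0; last first.
  by move=> j; rewrite mem_index_iota => /andP[_ /andP[lt_dj _]]; rewrite leqNgt lt_dj.
by rewrite big_mkord; apply: eq_bigr => j _; rewrite -ltnS ltn_ord.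
Qed.

Lemma pihomog0_eq0 p : p@_0%MM = 0 -> pihomog mdeg 0 p = 0.
Proof.
have [x Ex] := dhomog0C (pihomogP mdeg 0 p).
rewrite {1}(pihomog_partitionE (leqnSn (msize p))) big_ord_recl mcoeffD.
rewrite Ex raddf_sum mcoeffC eqxx mulr1 big1 ?addr0 => [->|i _] //.
by apply: (dhomog_nemf_coeff (pihomogP _ _ _)); rewrite /= mdeg0.
Qed.

(** The condition on a coefficient of a basis vector of degree [e] in a vector of degree [d]. The
    case [e > d] is separate because [d - e] would truncate to 0 and allow constants. *)
Definition shift_homog d e p : Prop :=
  if (e <= d)%N then is_true (p \is (d - e).-homog) else p = 0.

Lemma shift_homogD d e p q :
  shift_homog d e p -> shift_homog d e q -> shift_homog d e (p + q).
Proof.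
rewrite /shift_homog; case: ifP => _; first exact: dhomogD.
by move=> -> ->; rewrite addr0.
Qed.

Lemma shift_homogM d d' e p q :
  p \is d'.-homog -> shift_homog d e q -> shift_homog (d' + d) e (p * q).
Proof.
rewrite /shift_homog => hp; case: ifP => [le_ed hq|_ ->].
  by rewrite (leq_trans le_ed) ?leq_addl // -addnBA // dhomogM.
by rewrite mulr0; case: ifP; rewrite ?dhomog0.
Qed.

Lemma shift_homog0 d e : shift_homog d e 0.
Proof. by rewrite /shift_homog; case: ifP; rewrite ?dhomog0. Qed.

Variable D : 'rV[S]_m -> Prop.
Hypothesis D_pihomog : forall d v, D v -> D (map_mx (pihomog mdeg d) v).

Variables (r : nat) (Th : 'M[S]_(r, m)).
Hypothesis Th_in : forall i, D (row i Th).
Hypothesis Th_gen : forall v, D v -> exists c, v = c *m Th.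
Hypothesis Th_free : forall c : 'rV[S]_r, c *m Th = 0 -> c = 0.

Local Notation comp d v := (map_mx (pihomog mdeg d) v).

(* The components of the rows of [Th] generate [D], hence their classes span
   the r-dimensional space D / (x_1, .., x_n) D; a subfamily that is a basis of
   that space is a basis of [D], by induction on the degree. *)
Lemma exists_homog_basis :
  exists (e : 'I_r -> nat) (H : 'M[S]_(r, m)),
  [/\ forall i, D (row i H),
      forall i j, H i j \is (e i).-homog,
      forall c : 'rV[S]_r, c *m H = 0 -> c = 0
    & forall d v, D v -> (forall j, v 0 j \is d.-homog) ->
      exists2 c : 'rV[S]_r, v = c *m H & forall i, shift_homog d (e i) (c 0 i)].
Proof.
pose k := \max_i \max_j msize (Th i j).
have Th_sum i : row i Th = \sum_(d < k) comp d (row i Th).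
  apply/rowP => j; rewrite summxE mxE; under eq_bigr => d _ do rewrite !mxE.
  apply: pihomog_partitionE.
  by apply: (leq_trans _ (leq_bigmax i)); apply: (leq_bigmax j).
(* Each component of a generator is again in [D], so it has coordinates in the generators. *)
have [C HC] : exists C : 'I_r * 'I_k -> 'rV[S]_r,
    forall x : 'I_r * 'I_k, comp x.2 (row x.1 Th) = C x *m Th.
  apply: (fin_all_exists
    (P := fun (x : 'I_r * 'I_k) c => comp x.2 (row x.1 Th) = c *m Th)) => x.
  exact/Th_gen/D_pihomog/Th_in.
pose c0 (p : S) := p@_0%MM.
(* The rows are the coordinates of the components modulo the ideal of the variables, in the basis
   given by [Th]. *)
pose G : 'M[K]_(#|{: 'I_r * 'I_k}|, r) := \matrix_x map_mx c0 (C (enum_val x)).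
(* The components of a generator add up to it, so by freeness their coordinate rows add up to a unit
   row. *)
have Gfull : row_full G.
  rewrite -sub1mx; apply/row_subP => i; rewrite row1.
  have -> : (delta_mx 0 i : 'rV[K]_r) = \sum_(d < k) map_mx c0 (C (i, d)).
    have -> : delta_mx 0 i = map_mx c0 (delta_mx 0 i) :> 'rV[K]_r.
      by apply/rowP => j; rewrite !mxE /c0 rmorph_nat.
    rewrite -(raddf_sum (map_mx (mcoeff 0%MM))) /=; congr (map_mx _ _).
    apply/eqP; rewrite -subr_eq0; apply/eqP/Th_free.
    rewrite mulmxBl -rowE mulmx_suml {1}Th_sum.
    by under eq_bigr => d _ do rewrite (HC (i, d)); rewrite subrr.
  apply: summx_sub => d _.
  have -> : map_mx c0 (C (i, d)) = row (enum_rank (i, d)) G.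
    by rewrite rowK enum_rankK.
  exact: row_sub.
pose x i := enum_val (fullrankfun Gfull i).
pose M : 'M[S]_r := \matrix_i C (x i).
pose H := M *m Th; pose e i : nat := (x i).2.
have rowH i : row i H = comp (e i) (row (x i).1 Th).
  by rewrite row_mul rowK -HC.
have H_homog i j : H i j \is (e i).-homog.
  have := congr1 (fun u : 'rV_m => u 0 j) (rowH i); rewrite !mxE => ->.
  exact: pihomogP.
have M0_unit : map_mx c0 M \in unitmx.
  have -> : map_mx c0 M = rowsub (fullrankfun Gfull) G.
    by apply/matrixP => i j; rewrite !mxE.
  exact: fullrowsub_unit.
(* The constant term of the determinant is nonzero; multiplication by the adjugate then transfers
   freeness from [Th] to [H]. *)
have detM : \det M != 0.
  move: M0_unit; rewrite unitmxE unitfE; apply: contra_neq => M0.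
  by rewrite -[map_mx _ _]/(map_mx (mcoeff 0%MM) M) det_map_mx M0 rmorph0.
have H_in i : D (row i H) by rewrite rowH; apply/D_pihomog/Th_in.
exists e, H; split=> //.
  move=> c; rewrite mulmxA => /Th_free/(congr1 (mulmxr (\adj M))) /=.
  rewrite mul0mx -mulmxA mul_mx_adj mul_mx_scalar => cM.
  apply/rowP => i; have /rowP/(_ i)/eqP := cM.
  by rewrite !mxE mulf_eq0 (negPf detM) => /eqP.
pose good d v := exists2 c : 'rV[S]_r, v = c *m H & forall i, shift_homog d (e i) (c 0 i).
have good_sum d (I : finType) (F : I -> 'rV[S]_m) :
    (forall i, good d (F i)) -> good d (\sum_i F i).
  move=> gF; elim/big_ind: _ => //.
    by exists 0; rewrite ?mul0mx // => i; rewrite mxE; apply: shift_homog0.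
  move=> _ _ [c1 -> h1] [c2 -> h2]; exists (c1 + c2); first by rewrite mulmxDl.
  by move=> i; rewrite mxE; apply: shift_homogD.
have goodZ d d' p v : p \is d'.-homog -> good d v -> good (d' + d)%N (p *: v).
  move=> hp [c -> hc]; exists (p *: c); first by rewrite scalemxAl.
  by move=> i; rewrite mxE; apply: shift_homogM.
(* [N] inverts the constant part of [M], so the entries of 1 - NM have no constant term. *)
pose N : 'M[S]_r := map_mx (@mpolyC n K) (invmx (map_mx c0 M)).
have NM0 i j : ((1%:M - N *m M) i j)@_0%MM = 0.
  have <- : map_mx (mcoeff 0%MM) (1%:M - N *m M) i j = ((1%:M - N *m M) i j)@_0%MM.
    by rewrite mxE.
  rewrite map_mxB map_mxM map_mx1 /=.
  have -> : map_mx (mcoeff 0%MM) N = invmx (map_mx c0 M).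
    by apply/matrixP => i' j'; rewrite !mxE mcoeffC eqxx mulr1.
  by rewrite mulVmx // subrr mxE.
(* Writing v = qN H + q(1 - NM) Th, the degree [d] part of the last term uses only components of
   [Th] of degree below [d], where the induction hypothesis applies. *)
move=> d; elim/ltn_ind: d => d IHd v Dv hv.
have [q def_v] := Th_gen Dv.
have {def_v} def_v : v = q *m N *m H + q *m (1%:M - N *m M) *m Th.
  by rewrite mulmxBr mulmx1 mulmxBl /H !mulmxA addrC subrK.
have -> : v = comp d v by apply/rowP => j; rewrite mxE pihomog_dE.
rewrite {}def_v map_mxD /=.
set Q := q *m (_ - _).
have Q0 i : (Q 0 i)@_0%MM = 0.
  rewrite mxE raddf_sum big1 // => j _.
  by rewrite /= (rmorphM (mcoeff 0%MM)) /= NM0 mulr0.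
have -> : comp d (q *m N *m H) =
    (\row_i (if (e i <= d)%N then pihomog mdeg (d - e i) ((q *m N) 0 i) else 0)) *m H.
  apply/rowP => j; rewrite mxE mxE raddf_sum [RHS]mxE; apply: eq_bigr => i _ /=.
  rewrite mxE; case: leqP => [le_ed|lt_de].
    by rewrite -{1}(subnK le_ed) pihomogM.
  by rewrite (@pihomogM_lt _ _ _ (e i)) // mul0r.
have -> : comp d (Q *m Th) =
    \sum_i \sum_(j < d.+1) pihomog mdeg j (Q 0 i) *: comp (d - j)%N (row i Th).
  apply/rowP => l; rewrite mxE mxE raddf_sum summxE; apply: eq_bigr => i _ /=.
  rewrite pihomog_mul summxE; apply: eq_bigr => j _.
  by rewrite !mxE.
have [c -> hc] : good d (\sum_i \sum_(j < d.+1)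
    pihomog mdeg j (Q 0 i) *: comp (d - j)%N (row i Th)).
  apply: (good_sum _ _ _) => i; apply: (good_sum _ _ _) => -[j lt_jd] /=.
  case: j => [|j] in lt_jd *.
    rewrite pihomog0_eq0 // scale0r; exists 0; first by rewrite mul0mx.
    by move=> i'; rewrite mxE; apply: shift_homog0.
  rewrite -{1}(subnKC (m := j.+1) (n := d)) //.
  apply: goodZ; first exact: pihomogP.
  apply: IHd; first by lia.
    exact/D_pihomog/Th_in.
  by move=> l; rewrite mxE; apply: pihomogP.
rewrite -mulmxDl; eexists; first by [].
move=> i; rewrite mxE; apply: shift_homogD => //; rewrite mxE /shift_homog.
by case: (e i <= d)%N => //; apply: pihomogP.
Qed.

End GradedNakayama.

(** * Derivations as vectors of polynomials *)

Section VectorFields.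
Variable K : fieldType.
Local Notation S := {mpoly K[3]}.
Local Notation T := (dhomog 3 K).
Local Notation V d := {ffun 'I_3 -> T d}.
Local Notation space := {vspace 'rV[K]_3}.
Implicit Types (a b c : 'cV[K]_3) (L : seq 'cV[K]_3) (E : {fset space}).

Definition vfield (v : 'rV[S]_3) (f : S) : S := \sum_i v 0 i * f^`M(i).

Lemma vfield_is_linear v : linear (vfield v).
Proof.
move=> x f g; rewrite scaler_sumr -big_split; apply: eq_bigr => i _ /=.
by rewrite linearP /= mulrDr scalerAr.
Qed.
HB.instance Definition _ v :=
  GRing.isLinear.Build K S S _ (vfield v) (vfield_is_linear v).

Lemma vfield_derivation v : derivation (vfield v).
Proof.
move=> f g; rewrite /= /vfield mulr_suml mulr_sumr -big_split.
by apply: eq_bigr => i _ /=; rewrite mderivM; ring.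
Qed.

Lemma vfieldX v i : vfield v 'X_i = v 0 i.
Proof.
rewrite /vfield (bigD1 i) //= mderivX mnm1E eqxx scale1r.
have -> : (U_(i) - U_(i) = 0 :> 'X_{1..3})%MM.
  by apply/mnmP => j; rewrite mnmBE subnn mnm0E.
rewrite mpolyX0 mulr1 big1 ?addr0 // => j neq_ji.
by rewrite mderivX mnm1E eq_sym (negPf neq_ji) scale0r mulr0.
Qed.

Lemma derivation1 (theta : {linear S -> S}) : derivation theta -> theta 1 = 0.
Proof.
move=> der; have := der 1 1; rewrite !mulr1 mul1r => /eqP.
by rewrite -subr_eq0 opprD addNKr oppr_eq0 => /eqP.
Qed.

Lemma eq_derivation (theta eta : {linear S -> S}) :
    derivation theta -> derivation eta ->
  (forall i, theta 'X_i = eta 'X_i) -> theta =1 eta.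
Proof.
move=> dth det eqX f; rewrite [f]mpolyE !raddf_sum; apply: eq_bigr => m _ /=.
rewrite !linearZ /=; congr (_ *: _); rewrite mpolyXE_id.
elim/big_ind: _ => [|p q Ep Eq|i _]; first by rewrite !derivation1.
  by rewrite dth det Ep Eq.
elim: (m i) => [|k IHk]; first by rewrite !expr0 !derivation1.
by rewrite exprS dth det IHk eqX.
Qed.

Lemma derivation_formp (theta : {linear S -> S}) a :
  theta (formp a) = pairing a (fun i => theta 'X_i).
Proof. by rewrite raddf_sum; apply: eq_bigr => i _ /=; rewrite linearZ. Qed.

(** [L] represents every plane of [E] by some form, up to scalars; this replaces the quantification
    over all defining forms by a finite list. *)
Definition forms_of E L : Prop :=
  (forall a, a \in L -> a != 0 /\ kerform a \in E) /\
  (forall a, a != 0 -> kerform a \in E -> exists x, exists2 b, b \in L & a = x *: b).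

Lemma logder_vec E L (theta : {linear S -> S}) : forms_of E L ->
  logder E (fun=> 1%N) theta <->
  derivation theta /\ logvec L (fun i => theta 'X_i).
Proof.
move=> [L_E E_L]; split=> [[der th]|[der th]]; split=> // a.
  move=> La; have [nz_a Ea] := L_E a La; have [g] := th a nz_a Ea.
  by rewrite expr1 derivation_formp => ->; exists g.
move=> nz_a Ea; have [x [b Lb def_a]] := E_L a nz_a Ea.
have [g def_g] := th b Lb.
have nz_x : x != 0 by apply: contra_neq nz_a => x0; rewrite def_a x0 scale0r.
exists g; rewrite def_a !linearZ /= expr1 -scalerAr -def_g.
by rewrite derivation_formp.
Qed.

(** The logarithmic module is graded because the defining forms are homogeneous. *)
Lemma logvec_pihomog L d (v : 'rV[S]_3) :
  logvec L (v 0) -> logvec L (map_mx (pihomog mdeg d) v 0).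
Proof.
move=> Lv a La; have [g def_g] := Lv a La.
have -> : pairing a (map_mx (pihomog mdeg d) v 0) = pihomog mdeg d (pairing a (v 0)).
  by rewrite raddf_sum; apply: eq_bigr => i _; rewrite mxE -linearZ.
rewrite def_g; case: d => [|d].
  by exists 0; rewrite (pihomogM_lt _ (formp_homog a)) // mul0r.
by exists (pihomog mdeg d g); rewrite -(addn1 d) pihomogM // formp_homog.
Qed.

Definition homog_basis L r (e : 'I_r -> nat) (H : 'M[S]_(r, 3)) : Prop :=
  [/\ forall i, logvec L (row i H 0),
      forall i j, H i j \is (e i).-homog,
      forall c : 'rV[S]_r, c *m H = 0 -> c = 0
    & forall d (v : 'rV[S]_3), logvec L (v 0) -> (forall j, v 0 j \is d.-homog) ->
      exists2 c : 'rV[S]_r, v = c *m H & forall i, shift_homog d (e i) (c 0 i)].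

Lemma eq_logvec L (u v : 'I_3 -> S) : u =1 v -> logvec L u -> logvec L v.
Proof.
move=> eq_uv Lu a /Lu[g Eg]; exists g; rewrite -Eg.
by apply: eq_bigr => i _; rewrite eq_uv.
Qed.

Lemma free_homog_basis E L : forms_of E L -> free_arrangement E ->
  exists r (e : 'I_r -> nat) H, homog_basis L e H.
Proof.
move=> EL [r [theta [th_in th_gen]]]; exists r.
pose Th : 'M[S]_(r, 3) := \matrix_(i, j) theta i 'X_j.
have der i : derivation (theta i) by case: (th_in i).
apply: (@exists_homog_basis K 3 3 (fun v => logvec L (v 0)) _ r Th).
- by move=> d v; apply: logvec_pihomog.
- move=> i; have /(logder_vec _ EL)[_] := th_in i.
  by apply: eq_logvec => j; rewrite !mxE.
- move=> v Lv; have [|c [Ec _]] := th_gen (vfield v).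
    apply/(logder_vec _ EL); split; first exact: vfield_derivation.
    by apply: eq_logvec Lv => j; rewrite /= vfieldX.
  exists (\row_i c i); apply/rowP => j.
  have := Ec 'X_j; rewrite /= vfieldX => ->; rewrite mxE.
  by apply: eq_bigr => i _; rewrite !mxE.
(* Freeness follows from uniqueness of coordinates: both 0 and [c] express the zero derivation. *)
move=> c cTh; have [|c0 [_ uniq_c0]] := th_gen (vfield 0).
  apply/(logder_vec _ EL); split; first exact: vfield_derivation.
  move=> a _; exists 0; rewrite mul0r /pairing big1 // => i _.
  by rewrite /= vfieldX mxE scaler0.
have vfield0 f : vfield 0 f = 0 by rewrite /vfield big1 // => i _; rewrite mxE mul0r.
have c0E : c0 = [ffun=> 0].
  by apply: uniq_c0 => f; rewrite /= vfield0 big1 // => i _; rewrite ffunE mul0r.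
have : c0 = [ffun i => c 0 i].
  apply: uniq_c0 => f /=; rewrite vfield0.
  have thE i g : theta i g = vfield (row i Th) g.
    apply: (eq_derivation (der i) (vfield_derivation _)) => j.
    by rewrite /= vfieldX !mxE.
  under eq_bigr => i _ do rewrite ffunE thE /vfield mulr_sumr.
  rewrite exchange_big big1 //= => j _.
  have /rowP/(_ j) := cTh; rewrite mxE [RHS]mxE => cj.
  transitivity ((\sum_i c 0 i * Th i j) * f^`M(j)); last by rewrite cj mul0r.
  by rewrite mulr_suml; apply: eq_bigr => i _; rewrite mxE mulrA.
by rewrite c0E => /ffunP c_0; apply/rowP => i; have := c_0 i; rewrite !ffunE mxE.
Qed.

(** The degree [d] part is the direct sum of the copies of the forms of degree [d - e i], each
    multiplied by the [i]-th basis vector. Since no [e i] exceeds [d], no subtraction truncates. *)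
Lemma dim_logspace_basis L r (e : 'I_r -> nat) H d :
  homog_basis L e H -> (forall i, (e i <= d)%N) ->
  \dim (logspace L d) = (\sum_i 'C(d - e i + 2, d - e i))%N.
Proof.
move=> [H_in H_hom H_free H_gen] le_ed.
pose F i : 'Hom(T (d - e i), V d) :=
  linfun (fun g : T (d - e i) => [ffun j => mul_hom (H i j) (d - e i) d g] : V d).
have FE i (g : T (d - e i)) j : F i g j = (g : S) * H i j :> S.
  have lin : linear (fun g : T (d - e i) =>
      [ffun j => mul_hom (H i j) (d - e i) d g] : V d).
    by move=> x u w; apply/ffunP => j'; rewrite !ffunE linearP.
  pose F' : {linear T (d - e i) -> V d} := HB.pack (fun g : T (d - e i) =>
      [ffun j => mul_hom (H i j) (d - e i) d g] : V d)
    (GRing.isLinear.Build _ _ _ _ _ lin).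
  have -> : F i g = F' g by rewrite -(lfunE F').
  by rewrite /= ffunE mul_homE ?leq_subr // subKn.
have injF (us : forall i, T (d - e i)) : \sum_i F i (us i) = 0 -> forall i, us i = 0.
  move=> /ffunP s0 i; pose c : 'rV[S]_r := \row_i (us i : S).
  have /rowP/(_ i) : c = 0.
    apply: H_free; apply/rowP => j; rewrite !mxE.
    have := congr1 (@mpoly_of_dhomog 3 K d) (s0 j).
    rewrite sum_ffunE raddf_sum ffunE /= => s0j.
    rewrite -[RHS]s0j; apply: eq_bigr => i' _.
    by rewrite FE mxE.
  by rewrite !mxE => us0; apply: val_inj.
have dirF : directv (\sum_i limg (F i)).
  apply/directv_sum_independent => us us_in s0 i _.
  have [w Ew] : exists w : forall i, T (d - e i), forall i, us i = F i (w i).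
    apply: (fin_all_exists (P := fun i w => us i = F i w)) => i'.
    by have /memv_imgP[w _ ->] := us_in i' isT; exists w.
  rewrite Ew (injF w) ?linear0 //.
  by rewrite -[RHS]s0; apply: eq_bigr => i' _; rewrite Ew.
have -> : logspace L d = (\sum_i limg (F i))%VS.
  apply/vspaceP => v; apply/idP/memv_sumP => [/logspaceP Lv|[us us_in ->]].
    have [||c Ec hc] := H_gen d (\row_j (v j : S)).
    - by apply: eq_logvec Lv => j; rewrite mxE.
    - by move=> j; rewrite mxE; apply: dhomog_is_dhomog.
    exists (fun i => F i (homog_part (d - e i) (c 0 i))).
      by move=> i _; apply/memv_img/memvf.
    apply/ffunP => j; apply: val_inj.
    rewrite sum_ffunE raddf_sum /=.
    have /rowP/(_ j) := Ec; rewrite !mxE => ->; apply: eq_bigr => i _.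
    rewrite FE /= pihomog_dE //.
    by have := hc i; rewrite /shift_homog le_ed.
  apply: memv_suml => i _; have /memv_imgP[g _ ->] := us_in i isT.
  apply/logspaceP => a La; have [q Eq] := H_in i a La.
  exists ((g : S) * q); rewrite -mulrA -Eq mulr_sumr; apply: eq_bigr => j _.
  by rewrite FE scalerAr mxE.
rewrite (directvP dirF) /=; apply: eq_bigr => i _.
rewrite limg_dim_eq ?dim_dhomog //.
apply/eqP; rewrite -subv0 capfv; apply/subvP => g; rewrite memv_ker memv0 => /eqP g0.
have /rowP/(_ i) : (g : S) *: delta_mx 0 i = 0 :> 'rV[S]_r.
  apply: H_free; rewrite -scalemxAl -rowE; apply/rowP => j; rewrite !mxE -FE g0.
  by rewrite ffunE.
by rewrite !mxE !eqxx mulr1 => g_0; apply/eqP/val_inj.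
Qed.

End VectorFields.

(** Expansion of (d - e + 1)(d - e + 2), with the negative terms moved to the left to stay in the
    natural numbers. *)
Lemma double_bin d e : (e <= d)%N ->
  (2 * 'C(d - e + 2, d - e) + (2 * d + 3) * e = (d + 1) * (d + 2) + e ^ 2)%N.
Proof.
move=> /subnK; set m := (d - e)%N => <-.
have : (2 * 'C(m + 2, m) = (m + 1) * (m + 2))%N.
  have -> : 'C(m + 2, m) = 'C(m + 2, 2) by rewrite -[RHS]bin_sub ?leq_addl ?addnK.
  by rewrite -mul_bin_diag addn2 bin1 addn1 mulnC.
by move: ('C(m + 2, m)) => c; nia.
Qed.

(* Comparison of the coefficients of two quadratic polynomials in [d] whose
   difference is bounded. *)
Lemma quadratic_exponents r (e : 'I_r -> nat) N C d0 :
    (forall i, e i <= d0)%N ->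
    (forall d, d0 <= d ->
       3 * 'C(d + 2, d) <= (\sum_i 'C(d - e i + 2, d - e i)) + N * d.+1 /\
       (\sum_i 'C(d - e i + 2, d - e i)) + N * d.+1 <= 3 * 'C(d + 2, d) + C)%N ->
  [/\ r = 3%N, (\sum_i e i = N)%N & (\sum_i e i ^ 2 <= N + 2 * C)%N].
Proof.
move=> le_e bounds; set A := (\sum_i e i)%N; set B := (\sum_i e i ^ 2)%N.
have main d : (d0 <= d ->
    3 * ((d + 1) * (d + 2)) + (2 * d + 3) * A
      <= r * ((d + 1) * (d + 2)) + B + 2 * N * d.+1 /\
    r * ((d + 1) * (d + 2)) + B + 2 * N * d.+1
      <= 3 * ((d + 1) * (d + 2)) + 2 * C + (2 * d + 3) * A)%N.
  move=> le_d; have [] := bounds d le_d; set s := (\sum_i _)%N => lo hi.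
  have Es : (2 * s + (2 * d + 3) * A = r * ((d + 1) * (d + 2)) + B)%N.
    rewrite /s /A /B !big_distrr -big_split /=.
    under eq_bigr => i _ do rewrite (double_bin (leq_trans (le_e i) le_d)).
    by rewrite big_split /= sum_nat_const card_ord.
  have := double_bin (leq0n d); rewrite subn0 muln0 !addn0 => E3.
  by split; lia.
(* In each case below, [d] is taken so large that the leading term of the difference outweighs the
   lower ones. *)
have r3 : r = 3%N.
  apply/eqP; rewrite eqn_leq; apply/andP; split; rewrite leqNgt; apply/negP => lt_r.
    have [_] := main (d0 + 2 * C + 2 * A)%N ltac:(lia); nia.
  have [+ _] := main (d0 + B + 2 * N)%N ltac:(lia); nia.
have AN : A = N.
  apply/eqP; rewrite eqn_leq; apply/andP; split; rewrite leqNgt; apply/negP => ltA.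
    have [+ _] := main (d0 + B)%N ltac:(lia); rewrite r3; nia.
  have [_] := main (d0 + C + N)%N ltac:(lia); rewrite r3; nia.
split=> //; have [_] := main d0 (leqnn _); rewrite r3 AN; nia.
Qed.

(** * Degrees of a homogeneous basis *)

Section FreeExponents.
Variable K : fieldType.
Local Notation S := {mpoly K[3]}.
Implicit Types (a b c : 'cV[K]_3) (L : seq 'cV[K]_3).

(** A basis vector of degree 0 is a constant direction. Its pairings are constants divisible by
    linear forms, hence zero, and three independent forms then force it to vanish. *)
Lemma basis_degree_gt0 L r (e : 'I_r -> nat) H a b c : homog_basis L e H ->
  a \in L -> b \in L -> c \in L -> frame a b c -> forall i, (0 < e i)%N.
Proof.
move=> [H_in H_hom H_free _] La Lb Lc fr i; rewrite lt0n; apply/eqP => ei0.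
have [w Ew] : exists w : 'I_3 -> K, forall j, H i j = (w j)%:MP.
  apply: (fin_all_exists (P := fun j x => H i j = x%:MP)) => j.
  by apply: dhomog0C; have := H_hom i j; rewrite ei0.
have w0 l : l \in L -> (\row_j w j) *m l = 0.
  move=> /(H_in i)[g Eg]; have : pairing l (row i H 0) = 0.
    have hp : pairing l (row i H 0) \is 0.-homog.
      by apply: pairing_homog => j; rewrite mxE; have := H_hom i j; rewrite ei0.
    by rewrite -(pihomog_dE hp) Eg (pihomogM_lt _ (formp_homog l)).
  have -> : pairing l (row i H 0) = (((\row_j w j) *m l) 0 0)%:MP.
    rewrite mxE rmorph_sum; apply: eq_bigr => j _.
    by rewrite !mxE Ew -mul_mpolyC -rmorphM /= mulrC.
  by move/eqP; rewrite mpolyC_eq0 => /eqP l0; rewrite [LHS]mx11_scalar l0 raddf0.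
have /rowP wj0 := fr _ (w0 a La) (w0 b Lb) (w0 c Lc).
have /rowP/(_ i)/eqP : delta_mx 0 i = 0 :> 'rV[S]_r.
  apply: H_free; rewrite -rowE; apply/rowP => j.
  by have := wj0 j; rewrite !mxE Ew => ->.
by rewrite !mxE !eqxx oner_eq0.
Qed.

(** The Euler field is logarithmic of degree 1. As no basis vector has degree 0, its expansion needs
    one of degree 1. *)
Lemma euler_degree L r (e : 'I_r -> nat) H a b c : homog_basis L e H ->
  a \in L -> b \in L -> c \in L -> frame a b c -> exists i, e i = 1%N.
Proof.
move=> basis La Lb Lc fr; have e_gt0 := basis_degree_gt0 basis La Lb Lc fr.
have [_ _ _ H_gen] := basis.
pose X : 'rV[S]_3 := \row_j 'X_j.
have [||u Eu hu] := H_gen 1%N X.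
- move=> l _; exists 1; rewrite mul1r; apply: eq_bigr => j _.
  by rewrite mxE.
- by move=> j; rewrite mxE dhomogXU.
have [/existsP[i /eqP]|] := boolP [exists i, e i == 1%N]; first by exists i.
rewrite negb_exists => /forallP e_neq1.
have u0 : u = 0.
  apply/rowP => i; have := hu i; rewrite /shift_homog leqNgt.
  by rewrite ltn_neqAle e_gt0 eq_sym (e_neq1 i) mxE.
have /rowP/(_ 0)/eqP := Eu; rewrite u0 mul0mx !mxE => /eqP X0.
have := mcoeffXU K (0 : 'I_3) 0; rewrite X0 mcoeff0 eqxx => /esym/eqP.
by rewrite oner_eq0.
Qed.

(** The dimension is bounded below because each plane imposes at most d+1 conditions, and above by
    hypothesis. Comparison with the dimension computed from a basis constrains the degrees, one of
    which is 1. *)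
Theorem free_exponents (E : {fset {vspace 'rV[K]_3}}) L a b c C :
    forms_of E L -> free_arrangement E ->
    a \in L -> b \in L -> c \in L -> frame a b c ->
    (forall d, (size L <= d)%N ->
       \dim (logspace L d) + size L * d.+1 <= 3 * 'C(d + 2, d) + C)%N ->
  exists p q, [/\ (p + q + 1 = size L)%N & (1 + p ^ 2 + q ^ 2 <= size L + 2 * C)%N].
Proof.
move=> EL freeE La Lb Lc fr dimL.
have [r [e [H basis]]] := free_homog_basis EL freeE.
have lower d : (3 * 'C(d + 2, d) <= \dim (logspace L d) + size L * d.+1)%N.
  have : {in L, forall l, l != 0} by move=> l /EL.1[].
  elim: (L) => [|l L' IHL] nzL; first by rewrite dim_logspace0 mul0n addn0.
  apply: leq_trans (IHL _) _ => [l' L'l'|]; first by rewrite nzL // inE L'l' orbT.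
  have := dim_logspace_cons_ge L' d (nzL _ (mem_head _ _)).
  move: (\dim _) (\dim _) => x y; rewrite /= mulSn; lia.
have [||r3 sum_e sum_e2] := @quadratic_exponents r e (size L) C (size L + \max_i e i)%N.
- by move=> i; rewrite (leq_trans (leq_bigmax i)) ?leq_addl.
- move=> d le_d; rewrite -(dim_logspace_basis basis).
    by split; [apply: lower | apply: dimL; lia].
  by move=> i; have := leq_bigmax (F := e) i; lia.
subst r.
have [i ei1] := euler_degree basis La Lb Lc fr.
have [j [k Ejk]] : exists j k : 'I_3, forall F : 'I_3 -> nat,
    (\sum_l F l = F i + (F j + F k))%N.
  exists (lift i ord0), (lift i (lift ord0 ord0)) => F.
  by rewrite (bigD1_ord i) //= big_ord_recl big_ord1.
move: sum_e sum_e2; rewrite !Ejk ei1 => sum_e sum_e2.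
exists (e j), (e k); split; lia.
Qed.

End FreeExponents.

(** * Dyadic chains and near translates *)

Section DyadicChains.
Variable K : fieldType.
Hypothesis charK0 : [pchar K] =i pred0.
Implicit Types (x y u : K) (B D : seq K).

Lemma pchar0_natr_inj : injective (fun n => n%:R : K).
Proof.
have nat0 := (pcharf0P K).1 charK0.
move=> m n /eqP; wlog le_mn : m n / (m <= n)%N => [hw|] eq_mn.
  have [/hw|/ltnW/hw] := leqP m n; first exact.
  by rewrite eq_sym => /(_ eq_mn).
apply/eqP; rewrite eqn_leq le_mn -subn_eq0 -nat0 natrB //.
by rewrite subr_eq0 eq_sym.
Qed.

Lemma two_neq0 : 2%:R != 0 :> K.
Proof. by rewrite ((pcharf0P K).1 charK0). Qed.

(** Parity settles the cases with a zero exponent; otherwise both sides are halved. *)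
Lemma pow2_add_inj i j l m : (2 ^ i + 2 ^ j = 2 ^ l + 2 ^ m)%N -> i = l \/ i = m.
Proof.
elim: i j l m => [|i IHi] [|j] [|l] [|m]; rewrite ?expn0 ?expnS => E; auto; try lia.
- by right; congr S; apply/eqP; rewrite -(eqn_exp2l (m := 2)) //; apply/eqP; lia.
- by left; congr S; apply/eqP; rewrite -(eqn_exp2l (m := 2)) //; apply/eqP; lia.
have [|->|->] := IHi j l m; [lia | by left | by right].
Qed.

Definition dyadic u x : Prop := x = 0 \/ exists i, x = u * 2%:R ^+ i.

Lemma dyadic_double u x : dyadic u x -> dyadic u (2%:R * x).
Proof.
case=> [->|[i ->]]; first by left; rewrite mulr0.
by right; exists i.+1; rewrite exprS mulrCA.
Qed.

(** With exponents i, j, l, m of x, x + t, y, y + t, equality of the two differences reads 2^i + 2^m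
    = 2^l + 2^j. Then i = l gives x = y, while i = j would give t = 0. *)
Lemma dyadic_shift_unique u x y t : u != 0 -> t != 0 ->
    x != 0 -> x + t != 0 -> y != 0 -> y + t != 0 ->
    dyadic u x -> dyadic u (x + t) -> dyadic u y -> dyadic u (y + t) ->
  x = y.
Proof.
move=> nz_u nz_t /eqP nz_x /eqP nz_xt /eqP nz_y /eqP nz_yt.
case=> // -[i Ei] [|[j Ej]] // [|[l El]] // [|[m Em]] //.
have : (2 ^ i + 2 ^ m = 2 ^ l + 2 ^ j)%N.
  apply: pchar0_natr_inj; apply: (mulfI nz_u).
  rewrite !natrD !natrX !mulrDr -Ei -Ej -El -Em; ring.
case/pow2_add_inj => Eil; first by rewrite Ei El Eil.
case/eqP: nz_t; apply: (addrI x); rewrite addr0 Ej Ei Eil //.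
Qed.

Lemma dyadic_shift_opp u x t : u != 0 -> t != 0 ->
  dyadic u t -> dyadic u (- t) -> False.
Proof.
move=> nz_u nz_t [/eqP|[i Ei]]; first by rewrite (negPf nz_t).
case=> [/eqP|[j Ej]]; first by rewrite oppr_eq0 (negPf nz_t).
have /eqP : u * (2 ^ i + 2 ^ j)%:R = 0 by rewrite natrD !natrX mulrDr -Ei -Ej subrr.
rewrite mulf_eq0 (negPf nz_u) ((pcharf0P K).1 charK0) addn_eq0.
by rewrite !expn_eq0.
Qed.

(* At most one such pair consists of powers and at most one contains 0. *)
Lemma dyadic_shift_size u t (X : seq K) : u != 0 -> t != 0 -> uniq X ->
    {in X, forall x, dyadic u x} -> {in X, forall x, dyadic u (x + t)} ->
  (size X <= 2)%N.
Proof.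
move=> nz_u nz_t uX dX dXt; rewrite leqNgt; apply/negP => lt2.
have no_both : 0 \in X -> - t \in X -> False.
  move=> X0 Xt; have := dXt 0 X0; rewrite add0r => dt.
  exact: dyadic_shift_opp nz_u nz_t dt (dX _ Xt).
pose Y := [seq x <- X | (x != 0) && (x + t != 0)].
have sY : (size Y <= 1)%N.
  rewrite leqNgt; apply/negP => lt1.
  have uY : uniq Y by rewrite filter_uniq.
  have Yn i : (i < size Y)%N -> nth 0 Y i \in Y by apply: mem_nth.
  have := Yn 0%N (ltnW lt1); have := Yn 1%N lt1; rewrite !mem_filter.
  move=> /andP[/andP[n1 n1t] X1] /andP[/andP[n0 n0t] X0].
  have := dyadic_shift_unique nz_u nz_t n0 n0t n1 n1t
    (dX _ X0) (dXt _ X0) (dX _ X1) (dXt _ X1).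
  by move/eqP; rewrite nth_uniq // ltnW.
have : (size X <= size Y + 1)%N; last by lia.
have addt0 x : (x + t == 0) = (x == - t) by rewrite addr_eq0.
rewrite -(count_predC (fun x => (x != 0) && (x + t != 0)) X) -size_filter leq_add2l.
rewrite (eq_count (a2 := predU (pred1 0) (pred1 (- t)))); last first.
  by move=> x /=; rewrite negb_and !negbK addt0.
have := count_predUI (pred1 0) (pred1 (- t)) X.
rewrite !count_uniq_mem //.
case: (boolP (0 \in X)) (boolP (- t \in X)) => [X0|_] [Xt|_] //=; last 3 first.
- lia.
- lia.
- lia.
by have := no_both X0 Xt.
Qed.

(** In characteristic 0 the successive halves of a nonzero [x] are distinct, so they leave the
    finite list [B]; the last one before the first exit is taken. *)
Lemma half_descent B x : x != 0 -> x \in B ->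
  exists2 i, x / 2%:R ^+ i \in B & x / 2%:R ^+ i / 2%:R \notin B.
Proof.
move=> nz_x Bx.
have [j Bj] : exists j, x / 2%:R ^+ j \notin B.
  have inj : injective (fun i => x / 2%:R ^+ i : K).
    move=> i j /(mulfI nz_x)/invr_inj; rewrite -!natrX => /pchar0_natr_inj/eqP.
    by rewrite eqn_exp2l // => /eqP.
  have [/allP sub|/allPn[_ /mapP[j _ ->]]] :=
    boolP (all (mem B) [seq x / 2%:R ^+ i | i <- iota 0 (size B).+1]); last by exists j.
  have := uniq_leq_size _ sub; rewrite size_map size_iota ltnn.
  by rewrite map_inj_uniq // iota_uniq => /(_ isT).
case: (ex_minnP (ex_intro (fun j => x / 2%:R ^+ j \notin B) j Bj)) => -[|i] Bi min_i.
  by rewrite expr0 divr1 Bx in Bi.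
exists i; last by rewrite -mulrA -invfM -exprSr.
by apply: contraLR (ltnSn i) => /min_i; rewrite -leqNgt.
Qed.

(** Every nonzero element descends by halving to an element whose half is missing, and at most one
    such [u] exists. If there is none, [B] contains at most 0 and [u] is arbitrary. *)
Lemma half_chain B : (count [pred x | x / 2%:R \notin B] B <= 1)%N ->
  exists2 u, u != 0 & {in B, forall x, dyadic u x}.
Proof.
move=> cB; have [/hasP[u Bu /= nBu]|/hasPn noB] :=
  boolP (has [pred x | x / 2%:R \notin B] B).
  exists u; first by apply: contraNneq nBu => u0; rewrite u0 mul0r -u0.
  move=> x Bx; have [->|nz_x] := eqVneq x 0; first by left.
  have [i Bi nBi] := half_descent nz_x Bx; right; exists i.
  suff <- : x / 2%:R ^+ i = u by rewrite divfK // expf_neq0 ?two_neq0.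
  apply/eqP/negPn/negP => neq_u; move: cB; rewrite leqNgt => /negP; apply.
  rewrite -size_filter; apply: (@uniq_leq_size _ [:: u; x / 2%:R ^+ i]).
    by rewrite /= inE eq_sym neq_u.
  by move=> y; rewrite !inE mem_filter /= => /orP[]/eqP->; rewrite ?nBu ?nBi.
exists 1; first exact: oner_neq0.
move=> x Bx; left; apply/eqP/negPn/negP => nz_x.
have [i Bi nBi] := half_descent nz_x Bx.
by have := noB _ Bi; rewrite /= nBi.
Qed.

End DyadicChains.

Section NearTranslates.
Variable K : fieldType.
Hypothesis charK0 : [pchar K] =i pred0.
Implicit Types (bs ds : seq K) (a b c d : K).

Definition hits (f : K -> K) bs ds : nat := count (fun d => f d \in bs) ds.

Lemma hits_all f bs ds : hits f bs ds = size ds -> {in ds, forall d, f d \in bs}.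
Proof. by move=> /eqP; rewrite -all_count => /allP. Qed.

Lemma hits_miss f bs ds :
  count (fun d => f d \notin bs) ds = (size ds - hits f bs ds)%N.
Proof. by rewrite -(count_predC (fun d => f d \in bs) ds) addKn. Qed.

(** If nothing were missed, both translates of [ds] would be permutations of [bs]. Comparing sums
    gives n a1 = n a2 with n the size of [ds], impossible in characteristic 0. *)
Lemma hits_translate_lt bs ds a1 a2 :
    uniq ds -> size bs = size ds -> (0 < size ds)%N -> a1 != a2 ->
  (hits (fun d => d - a1)%R bs ds + hits (fun d => d - a2)%R bs ds
     < size ds + size ds)%N.
Proof.
move=> uds eq_size gt0 neq_a; rewrite ltnNge; apply: contra neq_a => ge.
have le_hits f : (hits f bs ds <= size ds)%N := count_size _ ds.
have perm_bs a : hits (fun d => d - a) bs ds = size ds ->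
    perm_eq [seq d - a | d <- ds] bs.
  move=> /hits_all all_in.
  have uD : uniq [seq d - a | d <- ds] by rewrite map_inj_uniq //; apply: addIr.
  have sub : {subset [seq d - a | d <- ds] <= bs}.
    by move=> _ /mapP[d /all_in ? ->].
  have le_size : (size bs <= size [seq (d - a)%R | d <- ds])%N.
    by rewrite size_map eq_size.
  have [_ eq_mem] := uniq_min_size uD sub le_size.
  apply: uniq_perm => //; rewrite -(eq_uniq _ eq_mem) //.
  by rewrite size_map eq_size.
have h1 := le_hits (fun d => d - a1); have h2 := le_hits (fun d => d - a2).
have E1 := perm_bs a1 ltac:(lia); have E2 := perm_bs a2 ltac:(lia).
have : \sum_(x <- [seq d - a1 | d <- ds]) x = \sum_(x <- [seq d - a2 | d <- ds]) x.
  by rewrite (perm_big _ E1) (perm_big _ E2).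
rewrite !big_map !sumrB => /addrI/oppr_inj/eqP.
rewrite !big_const_seq !count_predT !iter_addr_0 -subr_eq0 -mulrnBl -mulr_natr mulf_eq0.
by rewrite subr_eq0 ((pcharf0P K).1 charK0) eqn0Ngt gt0 orbF.
Qed.

(* Suppose at most two misses. After the translation by [a1], [ds] is [bs] up
   to few points, so [bs] is almost stable under the affine halving
   [b |-> (b + a1 - c) / 2] and is thus a dyadic chain around the fixed point
   [a1 - c]. The translation by [a2 - a1] maps most of such a chain into itself,
   which is impossible. *)
Lemma no_near_translates bs ds a1 a2 c :
    uniq bs -> uniq ds -> size bs = size ds -> (4 <= size ds)%N -> a1 != a2 ->
  (hits (fun d => d - a1)%R bs ds + hits (fun d => d - a2)%R bs ds +
   hits (fun d => (d - c) / 2%:R)%R bs ds + 2 < 3 * size ds)%N.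
Proof.
move=> ubs uds eq_size ge4.
wlog le_T : a1 a2 / (hits (fun d => d - a2)%R bs ds <=
                     hits (fun d => d - a1)%R bs ds)%N => [hw|] neq_a.
  have [/hw|/ltnW/hw] := leqP (hits (fun d => d - a2) bs ds)
                              (hits (fun d => d - a1) bs ds); first exact.
  by rewrite eq_sym => /(_ neq_a); lia.
have le_hits f : (hits f bs ds <= size ds)%N := count_size _ ds.
have := le_hits (fun d => d - a1); have := le_hits (fun d => (d - c) / 2%:R).
have := hits_translate_lt uds eq_size (leq_trans _ ge4) neq_a.
set T1 := hits _ bs ds; set T2 := hits _ bs ds in le_T *.
set T3 := hits _ bs ds => /(_ isT) ltT leT3 leT1; rewrite ltnNge; apply/negP => big.
have nz2 := two_neq0 charK0.
pose e0 := a1 - c; pose B := [seq b - e0 | b <- bs].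
have memB b : (b - e0 \in B) = (b \in bs).
  by apply: (mem_map (f := fun b => b - e0)); apply: addIr.
have uB : uniq B by rewrite map_inj_uniq //; apply: addIr.
(* A point b whose half-way image is missing either has b + a1 outside [ds], a miss of the first
   translation, or comes from d = b + a1 with (d - c)/2 outside [bs], a miss of the halving. *)
have bad_le : (count [pred x | (x / 2%:R)%R \notin B] B <=
               (size ds - T1) + (size ds - T3))%N.
  have Y1 : (count (fun b => (b + a1)%R \notin ds) bs <= size ds - T1)%N.
    rewrite (hits_miss (fun b => b + a1)) eq_size leq_sub2l //.
    rewrite /T1 /hits -!size_filter -(size_map (fun d => d - a1)).
    apply: uniq_leq_size.
      by rewrite map_inj_uniq ?filter_uniq //; apply: addIr.
    move=> _ /mapP[d + ->]; rewrite !mem_filter => /andP[-> d_in].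
    by rewrite subrK d_in.
  have Y3 := hits_miss (fun d => (d - c) / 2%:R) bs ds.
  apply: leq_trans (leq_add Y1 (eq_leq Y3)).
  rewrite -!size_filter -(size_map (fun b => b - e0)).
  rewrite -[X in (_ <= _ + X)%N](size_map (fun d => d - a1 - e0)) -size_cat.
  apply: uniq_leq_size; first by rewrite filter_uniq.
  move=> x; rewrite mem_filter /= => /andP[+ /mapP[b bs_b def_x]].
  rewrite {}def_x mem_cat => nB; have [b_ds|b_ds] := boolP (b + a1 \in ds).
    apply/orP; right; apply/mapP; exists (b + a1); last by rewrite addrK.
    rewrite mem_filter b_ds andbT -memB; apply: contra nB => nB.
    by rewrite [X in X \in _](_ : _ = (b + a1 - c) / 2%:R - e0) // /e0; field.
  by apply/orP; left; apply/mapP; exists b; rewrite // mem_filter b_ds.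
(* Two misses by the second translation leave none for the others: [B] is then stable under halving,
   hence contained in {0}, against its size. *)
have [s2|s2] := leqP 2 (size ds - T2).
  have {}bad_le : count [pred x | (x / 2%:R)%R \notin B] B = 0%N.
    by apply/eqP; rewrite -leqn0 (leq_trans bad_le) //; lia.
  have : {subset B <= [:: 0]}.
    move=> x Bx; rewrite inE; apply/negPn/negP => nz_x.
    have [i Bi nBi] := half_descent charK0 nz_x Bx.
    have : has [pred x | x / 2%:R \notin B] B by apply/hasP; exists (x / 2%:R ^+ i).
    by rewrite has_count bad_le.
  by move=> /(uniq_leq_size uB); rewrite size_map eq_size /=; lia.
have le1 : (size ds - T1 + (size ds - T3) <= 1)%N by lia.
have [u nz_u dB] := half_chain charK0 (leq_trans bad_le le1).
have nz_t : a2 - a1 != 0 by rewrite subr_eq0 eq_sym.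
(* At most one element is missed here, so [X] has at least three points. *)
pose X := [seq d - a2 - e0 | d <- ds & d - a2 \in bs].
have : (size X <= 2)%N.
  apply: (dyadic_shift_size charK0 nz_u nz_t).
  - by rewrite map_inj_uniq ?filter_uniq // => x y /addIr/addIr.
  - move=> _ /mapP[d + ->]; rewrite mem_filter => /andP[bs_d _].
    by apply: dB; rewrite memB.
  move=> _ /mapP[d + ->]; rewrite mem_filter => /andP[_ ds_d].
  have -> : d - a2 - e0 + (a2 - a1) = d - a1 - e0 by ring.
  (* The second translation misses at least once, so the first one and the halving share at most one
     miss and one of them is complete. *)
  have /orP[/eqP T1E|/eqP T3E] : (T1 == size ds) || (T3 == size ds) by lia.
    by apply: dB; rewrite memB; apply: (hits_all T1E).
  have -> : d - a1 - e0 = 2%:R * ((d - c) / 2%:R - e0) by rewrite /e0; field.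
  by apply: dyadic_double; apply: dB; rewrite memB; apply: (hits_all T3E).
by rewrite size_map size_filter -/(hits (fun d => d - a2) bs ds) -/T2; lia.
Qed.

End NearTranslates.

(** * Two lines, k lines, k lines and one line *)

Section ConcreteArrangement.
Variable K : fieldType.
Variables (X Y Z : 'cV[K]_3).
Hypothesis frXYZ : frame X Y Z.
Implicit Types (bs ds : seq K) (a b c d : K) (L P R : seq 'cV[K]_3).

Definition lin (x y z : K) : 'cV[K]_3 := x *: X + y *: Y + z *: Z.

(** Cramer's rule: the determinant times each coordinate of a common zero is a cofactor combination
    of the three equations. *)
Lemma frame_lin x1 y1 z1 x2 y2 z2 x3 y3 z3 :
    x1 * (y2 * z3 - y3 * z2) - y1 * (x2 * z3 - x3 * z2)
      + z1 * (x2 * y3 - x3 * y2) != 0 ->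
  frame (lin x1 y1 z1) (lin x2 y2 z2) (lin x3 y3 z3).
Proof.
set det := (X in X != 0) => nz_det w w1 w2 w3.
have coord x y z : w *m lin x y z = 0 ->
    x * (w *m X) 0 0 + y * (w *m Y) 0 0 + z * (w *m Z) 0 0 = 0.
  by move=> /matrixP/(_ 0 0); rewrite /lin !mulmxDr -!scalemxAr !mxE.
move: (coord _ _ _ w1) (coord _ _ _ w2) (coord _ _ _ w3).
set x := (w *m X) 0 0; set y := (w *m Y) 0 0; set z := (w *m Z) 0 0 => e1 e2 e3.
have x0 : x = 0.
  apply: (mulfI nz_det); rewrite mulr0.
  have -> : det * x = (y2 * z3 - y3 * z2) * (x1 * x + y1 * y + z1 * z)
     - (y1 * z3 - y3 * z1) * (x2 * x + y2 * y + z2 * z)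
     + (y1 * z2 - y2 * z1) * (x3 * x + y3 * y + z3 * z) by rewrite /det; ring.
  by rewrite e1 e2 e3; ring.
have y0 : y = 0.
  apply: (mulfI nz_det); rewrite mulr0.
  have -> : det * y = - (x2 * z3 - x3 * z2) * (x1 * x + y1 * y + z1 * z)
     + (x1 * z3 - x3 * z1) * (x2 * x + y2 * y + z2 * z)
     - (x1 * z2 - x2 * z1) * (x3 * x + y3 * y + z3 * z) by rewrite /det; ring.
  by rewrite e1 e2 e3; ring.
have z0 : z = 0.
  apply: (mulfI nz_det); rewrite mulr0.
  have -> : det * z = (x2 * y3 - x3 * y2) * (x1 * x + y1 * y + z1 * z)
     - (x1 * y3 - x3 * y1) * (x2 * x + y2 * y + z2 * z)
     + (x1 * y2 - x2 * y1) * (x3 * x + y3 * y + z3 * z) by rewrite /det; ring.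
  by rewrite e1 e2 e3; ring.
by apply: frXYZ; rewrite [LHS]mx11_scalar ?[_ 0 0]x0 ?[_ 0 0]y0 ?[_ 0 0]z0 raddf0.
Qed.

Lemma frame_lin_det v x1 y1 z1 x2 y2 z2 x3 y3 z3 :
    x1 * (y2 * z3 - y3 * z2) - y1 * (x2 * z3 - x3 * z2)
      + z1 * (x2 * y3 - x3 * y2) = v -> v != 0 ->
  frame (lin x1 y1 z1) (lin x2 y2 z2) (lin x3 y3 z3).
Proof. by move=> <-; apply: frame_lin. Qed.

Lemma lin_inj x1 y1 z1 x2 y2 z2 :
  lin x1 y1 z1 = lin x2 y2 z2 -> [/\ x1 = x2, y1 = y2 & z1 = z2].
Proof.
have lin0 x y z : lin x y z = 0 -> [/\ x = 0, y = 0 & z = 0].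
  move=> l0; split; apply/eqP/negPn/negP => nz.
  - have /frame_neq0/eqP[] // : frame (lin x y z) (lin 0 1 0) (lin 0 0 1).
    by apply: (@frame_lin_det x) => //; ring.
  - have /frame_neq0/eqP[] // : frame (lin x y z) (lin 0 0 1) (lin 1 0 0).
    by apply: (@frame_lin_det y) => //; ring.
  have /frame_neq0/eqP[] // : frame (lin x y z) (lin 1 0 0) (lin 0 1 0).
  by apply: (@frame_lin_det z) => //; ring.
move=> eq_lin; have /lin0[] : lin (x1 - x2) (y1 - y2) (z1 - z2) = 0.
  have -> : lin (x1 - x2) (y1 - y2) (z1 - z2) = lin x1 y1 z1 - lin x2 y2 z2.
    rewrite /lin !scalerBl !opprD -!addrA; congr (_ + _).
    by rewrite addrCA; congr (_ + _); rewrite [RHS]addrCA; congr (_ + _); rewrite addrCA.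
  by rewrite eq_lin subrr.
by move=> /subr0_eq-> /subr0_eq-> /subr0_eq->.
Qed.

(** In the affine chart Z = 1, [linf] is the line at infinity and the next four are x = a, y = b, x
    + y = d and x - y = c. *)
Definition linf : 'cV[K]_3 := lin 0 0 1.
Definition xline a : 'cV[K]_3 := lin 1 0 (- a).
Definition yline b : 'cV[K]_3 := lin 0 1 (- b).
Definition sline d : 'cV[K]_3 := lin 1 1 (- d).
Definition mline c : 'cV[K]_3 := lin 1 (-1) (- c).

Lemma yline_inj : injective yline.
Proof. by move=> a b /lin_inj[_ _ /oppr_inj]. Qed.
Lemma sline_inj : injective sline.
Proof. by move=> a b /lin_inj[_ _ /oppr_inj]. Qed.
Lemma xline_inj : injective xline.
Proof. by move=> a b /lin_inj[_ _ /oppr_inj]. Qed.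

(** [C] bounds how far the planes together fall short of d+1 independent conditions each. It is
    uniform in [d], as the comparison of quadratic polynomials requires. *)
Definition excess L (C : nat) : Prop := forall d : nat, (size L <= d)%N ->
  (\dim (logspace L d) + size L * d.+1 <= 3 * 'C(d + 2, d) + C)%N.

Lemma excess_cons l P R L C :
    excess L C -> perm_eq L (P ++ R) -> P != [::] -> uniq P ->
    {in P &, forall p q, p != q -> frame l p q} ->
    {in L, forall p, exists q, frame l p q} ->
  excess (l :: L) (C + size R).
Proof.
move=> exL eqL nzP uP frP frL d /= le_d.
have := dim_logspace_cons_le eqL nzP uP (ltnW (leqW le_d)) frP frL.
have := exL d (ltnW le_d); rewrite /= mulSn.
move: (\dim _) (\dim _) => x y; lia.
Qed.

Lemma linf_neq0 : linf != 0.
Proof.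
apply: (@frame_neq0 _ _ (lin 1 0 0) (lin 0 1 0)).
by apply: (@frame_lin_det 1); [ring | apply: oner_neq0].
Qed.

Lemma excess_linf : excess [:: linf] 0.
Proof.
move=> d _; rewrite addn0 mul1n.
by apply: leq_trans (dim_logspace1_le d linf_neq0) _; rewrite dim_logspace0.
Qed.

Definition spread l P : Prop := {in P &, forall p q, p != q -> frame l p q}.

Lemma frameC (p q r : 'cV[K]_3) : frame p q r -> frame p r q.
Proof. by move=> fr w wa wc wb; apply: fr. Qed.

Lemma spread_map (T : eqType) (f : T -> 'cV[K]_3) l (s : seq T) :
  (forall x y, x != y -> frame l (f x) (f y)) -> spread l (map f s).
Proof.
move=> fr _ _ /mapP[x _ ->] /mapP[y _ ->] neq; apply: fr.
by apply: contraNneq neq => ->.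
Qed.

Lemma spread_cat l P R : spread l P -> spread l R ->
  {in P & R, forall p q, frame l p q} -> spread l (P ++ R).
Proof.
move=> sP sR sPR b c; rewrite !mem_cat => /orP[Pb|Rb] /orP[Pc|Rc] neq.
- exact: sP.
- exact: sPR.
- by apply/frameC/sPR.
- exact: sR.
Qed.

Lemma spread1 l p : spread l [:: p].
Proof. by move=> q r; rewrite !inE => /eqP-> /eqP->; rewrite eqxx. Qed.

Definition ylines bs := [seq yline b | b <- bs] ++ [:: linf].
Definition xylines a1 a2 bs := [seq xline a | a <- [:: a1; a2]] ++ ylines bs.
Definition sxylines a1 a2 bs ds := [seq sline d | d <- ds] ++ xylines a1 a2 bs.

Lemma frame_yyx b b' a : b != b' -> frame (yline b) (yline b') (xline a).
Proof.
by move=> neq; apply: (@frame_lin_det (b - b')); [ring | rewrite subr_eq0].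
Qed.

Lemma frame_yzx b a : frame (yline b) linf (xline a).
Proof. by apply: (@frame_lin_det 1); [ring | apply: oner_neq0]. Qed.

Lemma frame_xyz a b : frame (xline a) (yline b) linf.
Proof. by apply: (@frame_lin_det 1); [ring | apply: oner_neq0]. Qed.

Lemma frame_xyy a b b' : b != b' -> frame (xline a) (yline b) (yline b').
Proof.
by move=> neq; apply: (@frame_lin_det (b - b')); [ring | rewrite subr_eq0].
Qed.

Lemma frame_xxy a a' b : a != a' -> frame (xline a) (xline a') (yline b).
Proof.
by move=> neq; apply: (@frame_lin_det (a' - a)); [ring | rewrite subr_eq0 eq_sym].
Qed.

Lemma frame_sxx d a a' : a != a' -> frame (sline d) (xline a) (xline a').
Proof.
by move=> neq; apply: (@frame_lin_det (a' - a)); [ring | rewrite subr_eq0 eq_sym].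
Qed.

Lemma frame_syy d b b' : b != b' -> frame (sline d) (yline b) (yline b').
Proof.
by move=> neq; apply: (@frame_lin_det (b - b')); [ring | rewrite subr_eq0].
Qed.

Lemma frame_syz d b : frame (sline d) (yline b) linf.
Proof. by apply: (@frame_lin_det 1); [ring | apply: oner_neq0]. Qed.

Lemma frame_sxz d a : frame (sline d) (xline a) linf.
Proof. by apply: (@frame_lin_det (-1)); [ring | rewrite oppr_eq0 oner_neq0]. Qed.

Lemma frame_syx d b a : d - a != b -> frame (sline d) (yline b) (xline a).
Proof.
by move=> neq; apply: (@frame_lin_det (d - a - b)); [ring | rewrite subr_eq0].
Qed.

Lemma frame_ssz d d' a : d != d' -> frame (sline d) (sline d') (xline a).
Proof.
by move=> neq; apply: (@frame_lin_det (d - d')); [ring | rewrite subr_eq0].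
Qed.

(** All these lines pass through one point at infinity, represented by [linf]; each new line
    therefore loses one condition per earlier parallel. *)
Lemma excess_ylines bs : uniq bs -> excess (ylines bs) 'C(size bs, 2).
Proof.
elim: bs => [|b bs IHbs]; first by move=> _; apply: excess_linf.
move=> /= /andP[nb ubs]; rewrite binS bin1 -[X in (_ + X)%N](size_map yline bs).
apply: (excess_cons (P := [:: linf]) (IHbs ubs)) => //.
- by rewrite /ylines perm_catC.
- exact: spread1.
move=> l; rewrite mem_cat inE => /orP[/mapP[b' bs_b' ->]|/eqP->].
  by exists (xline 0); apply: frame_yyx; apply: contraNneq nb => ->.
by exists (xline 0); apply: frame_yzx.
Qed.

Lemma ylines_uniq bs : uniq bs -> uniq (ylines bs).
Proof.
move=> ubs; rewrite cat_uniq /= orbF andbT map_inj_uniq ?ubs /=; last exact: yline_inj.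
by apply/mapP => -[b _ /lin_inj[_ /eqP]]; rewrite eq_sym oner_eq0.
Qed.

Lemma spread_xylines a bs : spread (xline a) (ylines bs).
Proof.
apply: spread_cat => [||_ q /mapP[b _ ->]]; last 1 first.
- by rewrite inE => /eqP->; apply: frame_xyz.
- by apply: spread_map => b b'; apply: frame_xyy.
exact: spread1.
Qed.

Lemma ylines_neq0 bs : ylines bs != [::].
Proof. by case: bs. Qed.

(** The first vertical line meets the present lines in distinct points. The second meets the first
    on [linf], which costs 1. *)
Lemma excess_xylines a1 a2 bs : a1 != a2 -> uniq bs ->
  excess (xylines a1 a2 bs) ('C(size bs, 2) + 1).
Proof.
move=> neq ubs.
have tr a : {in ylines bs, forall l, exists q, frame (xline a) l q}.
  move=> l; rewrite mem_cat inE => /orP[/mapP[b _ ->]|/eqP->].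
    by exists linf; apply: frame_xyz.
  by exists (yline 0); apply/frameC/frame_xyz.
have ex1 : excess (xline a2 :: ylines bs) 'C(size bs, 2).
  rewrite -[X in excess _ X]addn0.
  apply: (excess_cons (P := ylines bs) (R := [::]) (excess_ylines ubs)).
  - by rewrite cats0.
  - exact: ylines_neq0.
  - exact: ylines_uniq.
  - exact: spread_xylines.
  exact: tr.
apply: (excess_cons (P := ylines bs) (R := [:: xline a2]) ex1).
- by rewrite perm_sym (perm_catC (ylines bs)).
- exact: ylines_neq0.
- exact: ylines_uniq.
- exact: spread_xylines.
move=> l; rewrite inE => /predU1P[->|/tr //].
by exists (yline 0); apply: frame_xxy.
Qed.

(** A new line x + y = d meets its earlier parallels on [linf], and meets x = a on a line y = b
    exactly when d - a lies in [bs]. These lines form [R]; all others meet it in distinct points. *)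
Lemma excess_sxylines a1 a2 bs ds : a1 != a2 -> uniq bs -> uniq ds ->
  excess (sxylines a1 a2 bs ds) ('C(size bs, 2) + 1 + 'C(size ds, 2) +
    hits (fun d => d - a1)%R bs ds + hits (fun d => d - a2)%R bs ds).
Proof.
move=> neq ubs; elim: ds => [_|d ds IHds /= /andP[nd uds]].
  by rewrite /hits /= !addn0; apply: excess_xylines.
pose near := [seq a <- [:: a1; a2] | d - a \in bs].
pose far := [seq a <- [:: a1; a2] | d - a \notin bs].
pose P := ylines bs ++ [seq xline a | a <- far].
pose R := [seq sline d' | d' <- ds] ++ [seq xline a | a <- near].
have -> : ('C(size bs, 2) + 1 + 'C((size ds).+1, 2) +
    hits (fun d => d - a1)%R bs (d :: ds) + hits (fun d => d - a2)%R bs (d :: ds) =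
    'C(size bs, 2) + 1 + 'C(size ds, 2) +
    hits (fun d => d - a1)%R bs ds + hits (fun d => d - a2)%R bs ds + size R)%N.
  rewrite size_cat !size_map size_filter /hits /= binS bin1 addn0; lia.
apply: (excess_cons (P := P) (IHds uds)).
- have : perm_eq ([seq xline a | a <- near] ++ [seq xline a | a <- far])
                 [seq xline a | a <- [:: a1; a2]].
    by rewrite -map_cat perm_map // perm_filterC.
  move=> /permP cnt; apply/permP => p; have := cnt p.
  rewrite /sxylines /xylines /P /R !count_cat; lia.
- by rewrite /P /ylines; case: (bs).
- rewrite cat_uniq ylines_uniq //= map_inj_uniq ?filter_uniq ?andbT;
    last exact: xline_inj.
    apply/hasPn => _ /mapP[a _ ->]; rewrite mem_cat inE negb_or; apply/andP; split.
      by apply/mapP => -[b _ /lin_inj[/eqP]]; rewrite oner_eq0.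
    by apply/eqP => /lin_inj[/eqP]; rewrite oner_eq0.
  by rewrite /= inE neq.
- apply: spread_cat; first apply: spread_cat.
  + by apply: spread_map => b b'; apply: frame_syy.
  + exact: spread1.
  + move=> _ q /mapP[b _ ->]; rewrite inE => /eqP->; apply: frame_syz.
  + by apply: spread_map => a a'; apply: frame_sxx.
  move=> l _ + /mapP[a + ->]; rewrite mem_cat inE mem_filter.
  move=> /orP[/mapP[b bs_b ->]|/eqP->] /andP[far_a _]; last exact/frameC/frame_sxz.
  by apply: frame_syx; apply: contraNneq far_a => ->.
move=> l; rewrite !mem_cat; case/or4P.
- move=> /mapP[d' ds_d' ->]; exists (xline 0); apply: frame_ssz.
  by apply: contraNneq nd => ->.
- by move=> /mapP[a _ ->]; exists linf; apply: frame_sxz.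
- by move=> /mapP[b _ ->]; exists linf; apply: frame_syz.
by rewrite inE => /eqP->; exists (yline 0); apply/frameC/frame_syz.
Qed.

Lemma frame_myy c b b' : b != b' -> frame (mline c) (yline b) (yline b').
Proof.
by move=> neq; apply: (@frame_lin_det (b - b')); [ring | rewrite subr_eq0].
Qed.

Lemma frame_myz c b : frame (mline c) (yline b) linf.
Proof. by apply: (@frame_lin_det 1); [ring | apply: oner_neq0]. Qed.

Lemma frame_mxz c a : frame (mline c) (xline a) linf.
Proof. by apply: (@frame_lin_det 1); [ring | apply: oner_neq0]. Qed.

Hypothesis charK0 : [pchar K] =i pred0.

Lemma frame_mss c d d' : d != d' -> frame (mline c) (sline d) (sline d').
Proof.
move=> neq; apply: (@frame_lin_det (2%:R * (d - d'))); first ring.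
by rewrite mulf_neq0 ?two_neq0 ?subr_eq0.
Qed.

Lemma frame_msz c d : frame (mline c) (sline d) linf.
Proof. by apply: (@frame_lin_det 2%:R); [ring | apply: two_neq0]. Qed.

Lemma frame_mys c d b : (d - c) / 2%:R != b -> frame (mline c) (yline b) (sline d).
Proof.
have nz2 := two_neq0 charK0.
move=> neq; apply: (@frame_lin_det (2%:R * (b - (d - c) / 2%:R))); first by field.
by rewrite mulf_neq0 // subr_eq0 eq_sym.
Qed.

(** The lines x + y = d that meet the new one on some y = b go into [R]. Both vertical lines are put
    there too, whatever their position, which accounts for the 2. *)
Lemma excess_msxylines a1 a2 bs ds c : a1 != a2 -> uniq bs -> uniq ds ->
  excess (mline c :: sxylines a1 a2 bs ds)
    ('C(size bs, 2) + 1 + 'C(size ds, 2) +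
     hits (fun d => d - a1)%R bs ds + hits (fun d => d - a2)%R bs ds +
     (hits (fun d => (d - c) / 2%:R)%R bs ds + 2)).
Proof.
move=> neq ubs uds.
pose near := [seq d <- ds | (d - c) / 2%:R \in bs].
pose far := [seq d <- ds | (d - c) / 2%:R \notin bs].
pose P := ylines bs ++ [seq sline d | d <- far].
pose R := [seq sline d | d <- near] ++ [seq xline a | a <- [:: a1; a2]].
have -> : (hits (fun d => (d - c) / 2%:R)%R bs ds + 2 = size R)%N.
  by rewrite size_cat !size_map size_filter.
apply: (excess_cons (P := P) (excess_sxylines neq ubs uds)).
- have : perm_eq ([seq sline d | d <- near] ++ [seq sline d | d <- far])
                 [seq sline d | d <- ds].
    by rewrite -map_cat perm_map // perm_filterC.
  move=> /permP cnt; apply/permP => p; have := cnt p.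
  rewrite /sxylines /xylines /P /R !count_cat; lia.
- by rewrite /P /ylines; case: (bs).
- rewrite cat_uniq ylines_uniq //= map_inj_uniq ?filter_uniq ?andbT //;
    last exact: sline_inj.
  apply/hasPn => _ /mapP[d _ ->]; rewrite mem_cat inE negb_or; apply/andP; split.
    by apply/mapP => -[b _ /lin_inj[/eqP]]; rewrite oner_eq0.
  by apply/eqP => /lin_inj[/eqP]; rewrite oner_eq0.
- apply: spread_cat; first apply: spread_cat.
  + by apply: spread_map => b b'; apply: frame_myy.
  + exact: spread1.
  + by move=> _ q /mapP[b _ ->]; rewrite inE => /eqP->; apply: frame_myz.
  + by apply: spread_map => d d'; apply: frame_mss.
  move=> l _ + /mapP[d + ->]; rewrite mem_cat inE mem_filter.
  move=> /orP[/mapP[b bs_b ->]|/eqP->] /andP[far_d _]; last exact/frameC/frame_msz.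
  by apply: frame_mys; apply: contraNneq far_d => ->.
move=> l; rewrite !mem_cat; case/or4P.
- by move=> /mapP[d _ ->]; exists linf; apply: frame_msz.
- by move=> /mapP[a _ ->]; exists linf; apply: frame_mxz.
- by move=> /mapP[b _ ->]; exists linf; apply: frame_myz.
by rewrite inE => /eqP->; exists (yline 0); apply/frameC/frame_myz.
Qed.

(** With k lines in each family there are 2k + 4 planes, so p + q = 2k + 3 is odd and 2(p^2 + q^2)
    is at least (2k + 3)^2 + 1 = 4k^2 + 12k + 10. The bound on triple points allows at most 4k^2 +
    12k + 6. *)
Lemma not_free_msxylines (E : {fset {vspace 'rV[K]_3}}) a1 a2 bs ds c :
    a1 != a2 -> uniq bs -> uniq ds -> size bs = size ds -> (4 <= size ds)%N ->
    forms_of E (mline c :: sxylines a1 a2 bs ds) -> ~ free_arrangement E.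
Proof.
move=> neq ubs uds eq_size ge4 EL freeE.
case: bs => [|b bs] in ubs eq_size EL *; first by rewrite -eq_size in ge4.
have [|||p [q [sum_pq sq_pq]]] := free_exponents EL freeE _ _ _ (@frame_xyz a1 b)
  (excess_msxylines neq ubs uds).
- by rewrite /sxylines /xylines !(mem_cat, inE) eqxx ?orbT.
- by rewrite /sxylines /xylines /ylines !(mem_cat, inE) eqxx ?orbT.
- by rewrite /sxylines /xylines /ylines !(mem_cat, inE) eqxx ?orbT.
have := no_near_translates charK0 c ubs uds eq_size ge4 neq.
move: (hits _ _ _) (hits _ _ _) (hits _ _ _) sq_pq => t1 t2 t3.
have : (size (mline c :: sxylines a1 a2 (b :: bs) ds) = 2 * size ds + 4)%N.
  rewrite /sxylines /xylines /ylines /= !size_cat !size_map /= !size_cat size_map /=.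
  by rewrite -eq_size /=; lia.
move: sum_pq => /[swap] -> sum_pq; rewrite eq_size => sq_pq lt_t.
have C2 : (2 * 'C(size ds, 2) + size ds = size ds ^ 2)%N.
  have := mul_bin_diag (size ds) 1; rewrite bin1; case: (size ds) ge4 => // k _ /=.
  by move=> <-; rewrite -mulnn mulnS addnC.
move: sq_pq C2 sum_pq; rewrite -!mulnn.
move: (size ds) ('C(size ds, 2)) lt_t => k C lt_t sq_pq C2 sum_pq.
have [e [e_gt0 Epq]] : exists e, (0 < e)%N /\ (q = p + e \/ p = q + e)%N.
  by have [lt|lt|eq] := ltngtP p q; [exists (q - p)%N | exists (p - q)%N | ]; lia.
have e2 : (1 <= e * e)%N by nia.
suff : ((2 * k + 3) * (2 * k + 3) + 1 <= 2 * (p * p + q * q))%N by lia.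
have -> : (2 * k + 3 = p + q)%N by lia.
by case: Epq => ->; lia.
Qed.

End ConcreteArrangement.

(** * Coordinates of an extension *)

Section Kernels.
Variables (K : fieldType) (n : nat).
Implicit Types (a b : 'cV[K]_n) (v w : 'rV[K]_n).

Lemma mem_kerform a v : (v \in kerform a) = (v *m a == 0).
Proof. by rewrite memv_ker lfunE. Qed.

(** With b(w0) = 1, the vector e_j - b_j w0 lies in the kernel of [b], hence of [a]; this gives a_j
    = a(w0) b_j. *)
Lemma kerform_sub a b : b != 0 -> (kerform b <= kerform a)%VS ->
  exists x, a = x *: b.
Proof.
move=> /cV0Pn[i nz_bi] /subvP sub_ba.
pose w0 : 'rV[K]_n := (b i 0)^-1 *: delta_mx 0 i.
have w0b : (w0 *m b) 0 0 = 1 by rewrite -scalemxAl -rowE !mxE mulVf.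
exists ((w0 *m a) 0 0); apply/colP => j.
pose v : 'rV[K]_n := delta_mx 0 j - (b j 0) *: w0.
have entry (c : 'cV[K]_n) : (v *m c) 0 0 = c j 0 - b j 0 * (w0 *m c) 0 0.
  by rewrite mulmxBl -scalemxAl -rowE !mxE.
have : v \in kerform a.
  apply: sub_ba; rewrite mem_kerform; apply/eqP.
  by rewrite [LHS]mx11_scalar entry w0b mulr1 subrr raddf0.
rewrite mem_kerform => /eqP va; have := entry a; rewrite va mxE => /esym/subr0_eq ->.
by rewrite [RHS]mxE mulrC.
Qed.

Lemma kerformZ x a : x != 0 -> kerform (x *: a) = kerform a.
Proof.
move=> nz_x; apply/vspaceP => v; rewrite !mem_kerform -scalemxAr.
by rewrite scaler_eq0 (negPf nz_x).
Qed.

Lemma eq_kerform a b : b != 0 -> kerform a = kerform b -> exists x, a = x *: b.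
Proof. by move=> nz_b eq_ab; apply: kerform_sub; rewrite ?eq_ab. Qed.

End Kernels.

Lemma map_surj_seq (T U : eqType) (f : T -> U) (s : seq U) :
  {in s, forall y, exists x, y = f x} -> exists t, s = map f t.
Proof.
elim: s => [|y s IHs] hs; first by exists [::].
have [|t ->] := IHs; first by move=> z sz; apply: hs; rewrite inE sz orbT.
by have [x ->] := hs y (mem_head _ _); exists (x :: t).
Qed.

Section Coordinates.
Variable K : fieldType.
Variables (E : {fset {vspace 'rV[K]_3}}) (H : {vspace 'rV[K]_3}).
Variable phi : 'Hom('rV[K]_2, 'rV[K]_3).
Hypothesis arrE : arrangement E.
Hypothesis E_H : H \in E.
Hypothesis phi_inj : lker phi = 0%VS.
Hypothesis phi_img : limg phi = H.

Local Notation form_x := (form_x K).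
Local Notation form_y := (form_y K).

(** [Z] defines [H], while [X] and [Y] extend the two coordinate forms of the plane by a one-sided
    inverse of the matrix of [phi]. The [z] coordinate disappears on [H]. *)
Lemma extension_frame : exists X Y Z : 'cV[K]_3,
  [/\ frame X Y Z, H = kerform Z &
    forall v x y z, phi v *m lin X Y Z x y z = v *m (x *: form_x + y *: form_y)].
Proof.
have [Z nz_Z defH] := arrE E_H.
pose P := lin1_mx phi.
have phiE v : phi v = v *m P by rewrite mul_rV_lin1.
have freeP : row_free P.
  rewrite -kermx_eq0; apply/rowV0P => v /sub_kermxP vP.
  by apply/eqP; rewrite -memv0 -phi_inj memv_ker phiE vP.
pose X := pinvmx P *m form_x; pose Y := pinvmx P *m form_y.
have phiX v : phi v *m X = v *m form_x.
  by rewrite phiE -mulmxA (mulmxA P) (mulmxVp freeP) mul1mx.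
have phiY v : phi v *m Y = v *m form_y.
  by rewrite phiE -mulmxA (mulmxA P) (mulmxVp freeP) mul1mx.
have phiZ v : phi v *m Z = 0.
  by apply/eqP; rewrite -mem_kerform -defH -phi_img memv_img ?memvf.
exists X, Y, Z; split=> //.
  move=> w wX wY wZ.
  have : w \in limg phi by rewrite phi_img defH mem_kerform wZ.
  case/memv_imgP => v _ def_w; rewrite def_w.
  move: wX wY; rewrite def_w phiX phiY -!colE => /matrixP/(_ 0 0) + /matrixP/(_ 0 0).
  rewrite !mxE => v0 v1; rewrite [v](_ : _ = 0) ?linear0 //.
  apply/rowP => i; rewrite mxE; case: i => -[|[|//]] lt_i.
    by rewrite -[RHS]v0; congr (v _ _); apply: val_inj.
  by rewrite -[RHS]v1; congr (v _ _); apply: val_inj.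
move=> v x y z; rewrite /lin !mulmxDr -!scalemxAr phiX phiY phiZ.
by rewrite scaler0 addr0.
Qed.

Variables X Y Z : 'cV[K]_3.
Hypothesis frXYZ : frame X Y Z.
Hypothesis defH : H = kerform Z.
Hypothesis phi_lin : forall v x y z,
  phi v *m lin X Y Z x y z = v *m (x *: form_x + y *: form_y).

Lemma lin_span (a : 'cV[K]_3) : exists x y z, a = lin X Y Z x y z.
Proof. exact: frame_span. Qed.

Lemma form_xy_eq0 (x y : K) : x *: form_x + y *: form_y = 0 -> x = 0 /\ y = 0.
Proof.
move=> /colP f0; have := f0 0; have := f0 1; rewrite !mxE /=.
by rewrite !mulr1 !mulr0 add0r addr0.
Qed.

(** Pulled back by [phi], the form of H' is a multiple l of the given one. If l were 0 then H' would
    be [H]; dividing by l normalizes the first two coordinates. *)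
Lemma line_through (x y : K) H' : x *: form_x + y *: form_y != 0 ->
    H' \in E -> H' != H ->
    (phi @: kerform (x *: form_x + y *: form_y) <= H')%VS ->
  exists t, H' = kerform (lin X Y Z x y (- t)).
Proof.
move=> nz_f E_H' neq_H sub_H'.
have [a nz_a def_H'] := arrE E_H'.
have [x' [y' [z def_a]]] := lin_span a.
have [l def_l] : exists l, x' *: form_x + y' *: form_y = l *: (x *: form_x + y *: form_y).
  apply: kerform_sub => //; apply/subvP => v v_in.
  have := subvP sub_H' _ (memv_img phi v_in).
  by rewrite def_H' !mem_kerform def_a phi_lin.
have [Ex Ey] : x' = l * x /\ y' = l * y.
  have [|/subr0_eq ? /subr0_eq ?] := @form_xy_eq0 (x' - l * x) (y' - l * y); last by [].
  rewrite !scalerBl -!scalerA addrACA def_l -opprD -scalerDr subrr //.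
have nz_l : l != 0.
  apply: contraNneq neq_H => l0; rewrite def_H' defH def_a Ex Ey l0 !mul0r.
  have nz_z : z != 0.
    apply: contraNneq nz_a => z0.
    by rewrite def_a Ex Ey l0 z0 /lin !mul0r !scale0r !addr0.
  by rewrite /lin !scale0r !add0r kerformZ.
exists (- (z / l)); rewrite def_H' def_a opprK -[RHS](kerformZ _ nz_l); congr kerform.
by rewrite /lin !scalerDr !scalerA Ex Ey [l * (z / l)]mulrCA divff // mulr1.
Qed.

Lemma lines_through (x y : K) m : x *: form_x + y *: form_y != 0 ->
    ziegler_mult E (phi @: kerform (x *: form_x + y *: form_y))%VS = m ->
  exists ts : seq K, [/\ uniq ts, size ts = m,
    forall t, t \in ts -> kerform (lin X Y Z x y (- t)) \in E &
    forall H', H' \in E -> H' != H ->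
      (phi @: kerform (x *: form_x + y *: form_y) <= H')%VS ->
      exists2 t, t \in ts & H' = kerform (lin X Y Z x y (- t))].
Proof.
move=> nz_f; set L := (phi @: _)%VS => Em.
(* [H] itself contains the line, which is the 1 subtracted in [ziegler_mult]; so exactly [m] planes
   other than [H] remain. *)
pose G := ([fset H' in E | (L <= H')%VS] `\ H)%fset.
have memG H' : (H' \in G) = [&& H' != H, H' \in E & (L <= H')%VS].
  by rewrite !inE.
have sizeG : size (enum_fset G) = m.
  rewrite -Em /ziegler_mult /G -/L (cardfsD1 H [fset H' in E | (L <= H')%VS]%fset).
  by rewrite !inE E_H /= -phi_img limgS ?subvf // add1n subn1.
have [ts Ets] : exists ts, enum_fset G = [seq kerform (lin X Y Z x y (- t)) | t <- ts].
  apply: map_surj_seq => H'; rewrite memG => /and3P[neq_H E_H' LH'].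
  exact: line_through.
exists ts; split.
- by have := fset_uniq G; rewrite Ets => /map_uniq.
- by rewrite -sizeG Ets size_map.
- move=> t ts_t; have : kerform (lin X Y Z x y (- t)) \in G.
    rewrite [_ \in _](_ : _ = (kerform (lin X Y Z x y (- t)) \in enum_fset G)) // Ets.
    by apply/mapP; exists t.
  by rewrite memG => /and3P[].
move=> H' E_H' neq_H LH'; have : H' \in G by rewrite memG neq_H E_H'.
rewrite -[_ \in _]/(H' \in enum_fset G) Ets => /mapP[t ts_t ->].
by exists t.
Qed.

End Coordinates.

Lemma mem_fset4 (T : choiceType) (a b c d : T) :
  let A := [fset a; b; c; d]%fset in [/\ a \in A, b \in A, c \in A & d \in A].
Proof. by split; rewrite !inE eqxx ?orbT. Qed.

Lemma fset4_cases (T : choiceType) (a b c d x : T) :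
  x \in [fset a; b; c; d]%fset -> [\/ x = a, x = b, x = c | x = d].
Proof.
rewrite !inE -!orbA.
by case/or4P => /eqP->; [constructor 1 | constructor 2 | constructor 3 | constructor 4].
Qed.

(** * The four lines of type B2 and their multiplicities *)

Section MultiplicitiesB2.
Variable K : fieldType.
Hypothesis charK0 : [pchar K] =i pred0.
Local Notation form_x := (form_x K).
Local Notation form_y := (form_y K).
Local Notation ker2 x y := (kerform (x *: form_x + y *: form_y)).

Lemma B2_formsE : [/\ kerform form_x = ker2 1 0, kerform form_y = ker2 0 1,
  kerform (form_x - form_y) = ker2 1 (-1) & kerform (form_x + form_y) = ker2 1 1].
Proof. by split; rewrite ?scale1r ?scale0r ?addr0 ?add0r ?scaleN1r. Qed.

Lemma ker2_neq (x y x' y' : K) : x * y' != y * x' -> ker2 x y != ker2 x' y'.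
Proof.
move=> neq; apply/eqP => eq_ker; have [l El] : exists l,
    x *: form_x + y *: form_y = l *: (x' *: form_x + y' *: form_y).
  apply: eq_kerform eq_ker; apply: contraNneq neq.
  by move=> /form_xy_eq0[-> ->]; rewrite !mulr0.
have [|/subr0_eq Ex /subr0_eq Ey] := @form_xy_eq0 K (x - l * x') (y - l * y').
  by rewrite !scalerBl -!scalerA addrACA El -opprD -scalerDr subrr.
by case/eqP: neq; rewrite Ex Ey; ring.
Qed.

(** The nested tests of [B2_mult] are resolved by distinctness of the four lines; x - y and x + y
    are separated because 2 is nonzero. *)
Lemma B2_multE k : [/\ B2_mult k (ker2 1 0) = 2%N, B2_mult k (ker2 0 1) = k,
  B2_mult k (ker2 1 (-1)) = 1%N & B2_mult k (ker2 1 1) = k].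
Proof.
have [Ex Ey Em Ep] := B2_formsE; rewrite /B2_mult Ex Ey Em Ep.
have nz2 := two_neq0 charK0; have nz1 := oner_neq0 K.
have x_y : ker2 0 1 != ker2 1 0 by apply: ker2_neq; rewrite !mul0r mul1r eq_sym.
have x_m : ker2 1 (-1) != ker2 1 0.
  by apply: ker2_neq; rewrite mulr0 mulr1 eq_sym oppr_eq0.
have y_m : ker2 1 (-1) != ker2 0 1 by apply: ker2_neq; rewrite mulr0 mulr1.
have x_p : ker2 1 1 != ker2 1 0 by apply: ker2_neq; rewrite mulr0 mulr1 eq_sym.
have y_p : ker2 1 1 != ker2 0 1 by apply: ker2_neq; rewrite mulr0 mulr1.
have m_p : ker2 1 1 != ker2 1 (-1).
  by apply: ker2_neq; rewrite !mul1r eq_sym -subr_eq0 opprK.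
by rewrite !eqxx (negPf x_y) (negPf x_m) (negPf y_m) (negPf x_p) (negPf y_p) (negPf m_p).
Qed.

Lemma mem_B2 H : H \in B2 K ->
  [\/ H = ker2 1 0, H = ker2 0 1, H = ker2 1 (-1) | H = ker2 1 1].
Proof.
have [Ex Ey Em Ep] := B2_formsE; rewrite /B2 Ex Ey Em Ep.
exact: fset4_cases.
Qed.

Lemma B2_mem : [/\ ker2 1 0 \in B2 K, ker2 0 1 \in B2 K,
  ker2 1 (-1) \in B2 K & ker2 1 1 \in B2 K].
Proof.
have [Ex Ey Em Ep] := B2_formsE; rewrite /B2 Ex Ey Em Ep.
exact: mem_fset4.
Qed.

End MultiplicitiesB2.

Theorem theorem1p1 (K : fieldType) (charK0 : [pchar K]%R =i pred0) (k : nat) :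
  (4 <= k)%N ->
  ~ (exists E : {fset {vspace 'rV[K]_3}}, free_extension (B2 K) (B2_mult (K := K) k) E).
Proof.
move=> ge4 [E [[arrE [H E_H [phi [phi_inj phi_img restrE multE]]]] freeE]].
have [X [Y [Z [frXYZ defH phi_lin]]]] := extension_frame arrE E_H phi_inj phi_img.
have [Bx By Bm Bp] := B2_mem K; have [mx my mm mp] := B2_multE charK0 k.
have nz_form (x y : K) : (x != 0) || (y != 0) -> x *: form_x K + y *: form_y K != 0.
  by apply: contraL => /eqP/form_xy_eq0[-> ->]; rewrite eqxx.
have nz1 := oner_neq0 K.
have lines x y (nz : (x != 0) || (y != 0)) :=
  lines_through arrE E_H phi_img frXYZ defH phi_lin (nz_form x y nz).
have nz10 (y : K) : (1 != 0 :> K) || (y != 0) by rewrite nz1.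
have nz01 : (0 != 0 :> K) || (1 != 0 :> K) by rewrite nz1 orbT.
(* The multiplicities 2, k, 1, k become the numbers of affine lines in the four parallel classes. *)
have [as_ [ua size_a E_x x_E]] := lines _ 1 0 (nz10 0) (etrans (esym (multE _ Bx)) mx).
have [bs [ubs size_bs E_y y_E]] := lines _ 0 1 nz01 (etrans (esym (multE _ By)) my).
have [cs [_ size_c E_m m_E]] := lines _ 1 (-1) (nz10 (-1)) (etrans (esym (multE _ Bm)) mm).
have [ds [uds size_ds E_p p_E]] := lines _ 1 1 (nz10 1) (etrans (esym (multE _ Bp)) mp).
case: as_ => [|a1 [|a2 []]] // in ua size_a E_x x_E.
case: cs => [|c []] // in size_c E_m m_E.
have neq_a : a1 != a2 by move: ua; rewrite /= inE => /andP[].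
have linfE : linf X Y Z = Z by rewrite /linf /lin !scale0r !add0r scale1r.
apply: (not_free_msxylines frXYZ charK0 neq_a ubs uds _ _ (c := c) _ freeE).
- by rewrite size_bs size_ds.
- by rewrite size_ds.
split.
  move=> a; rewrite inE => /predU1P[->|].
    split; first exact: frame_neq0 (@frame_mxz _ _ _ _ frXYZ c 0).
    by apply: E_m; rewrite inE.
  rewrite !mem_cat; case/or4P.
  - move=> /mapP[d ds_d ->]; split; last exact: E_p.
    exact: frame_neq0 (@frame_sxz _ _ _ _ frXYZ d 0).
  - move=> /mapP[d ds_d ->]; split; last exact: E_x.
    exact: frame_neq0 (@frame_xyz _ _ _ _ frXYZ d 0).
  - move=> /mapP[d ds_d ->]; split; last exact: E_y.
    exact: frame_neq0 (@frame_yzx _ _ _ _ frXYZ d 0).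
  by rewrite inE => /eqP->; split; rewrite ?linf_neq0 // linfE -defH.
move=> a nz_a E_a.
pose L := mline X Y Z c :: sxylines X Y Z a1 a2 bs ds.
suff [l [L_l nz_l] eq_l] : exists2 l, l \in L /\ l != 0 & kerform a = kerform l.
  by have [x ->] := eq_kerform nz_l eq_l; exists x, l.
have [eq_H|neq_H] := eqVneq (kerform a) H.
  exists Z; last by rewrite eq_H.
  split; last by rewrite -linfE linf_neq0.
  by rewrite -linfE /L inE !mem_cat (mem_head (linf X Y Z) [::]) !orbT.
(* Any other plane of [E] cuts [H] in a member of the restriction, hence in the image of one of the
   four lines, and so appears in one of the four lists. *)
have : (H :&: kerform a)%VS \in restriction E H.
  have E_a' : kerform a \in (E `\ H)%fset by rewrite in_fsetD1 neq_H E_a.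
  exact: (in_imfset _ (fun H' => H :&: H')%VS E_a').
rewrite -restrE => /imfsetP[X0 /= B2_X0 eq_X0].
have sub_a : (phi @: X0 <= kerform a)%VS by rewrite -eq_X0 capvSr.
case: (mem_B2 B2_X0) => def_X0; rewrite def_X0 in sub_a.
- have [t ts_t ->] := x_E _ E_a neq_H sub_a; exists (xline X Y Z t) => //.
  split; last exact: frame_neq0 (@frame_xyz _ _ _ _ frXYZ t 0).
  by rewrite /L inE !mem_cat (map_f (xline X Y Z) ts_t) !orbT.
- have [t ts_t ->] := y_E _ E_a neq_H sub_a; exists (yline X Y Z t) => //.
  split; last exact: frame_neq0 (@frame_yzx _ _ _ _ frXYZ t 0).
  by rewrite /L inE !mem_cat (map_f (yline X Y Z) ts_t) !orbT.
- have [t ts_t ->] := m_E _ E_a neq_H sub_a; exists (mline X Y Z t) => //.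
  split; last exact: frame_neq0 (@frame_mxz _ _ _ _ frXYZ t 0).
  by move: ts_t; rewrite inE => /eqP->; rewrite /L inE eqxx.
have [t ts_t ->] := p_E _ E_a neq_H sub_a; exists (sline X Y Z t) => //.
split; last exact: frame_neq0 (@frame_sxz _ _ _ _ frXYZ t 0).
by rewrite /L inE !mem_cat (map_f (sline X Y Z) ts_t) !orbT.
Qed.
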